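(* If $X$ is a metric space with (finite) Assouad dimension $D$ and if $\mu$ is a Radon measure on $X$, then $\mathscr X(\mu)$ has index locally bounded by $D$.
   Context: The Assouad dimension of a metric space is the infimum of the $D$ for which there is a constant $C$ such that, for each $\varepsilon\in(0,1)$ and $R>0$, every set of diameter $\le R$ can be covered by at most $C\varepsilon^{-D}$ sets of diameter $\le\varepsilon R$. $\operatorname{Lip}_b(X)$ is the algebra of bounded real Lipschitz functions with norm $\max(\|f\|_\infty,\mathbf L(f))$, $\mathbf L(f)$ being the global Lipschitz constant; it is a dual Banach space, and $f_n\to f$ weak* iff $f_n\to f$ pointwise and the $f_n$ are bounded in norm. A derivation is a bounded linear map $D\colon\operatorname{Lip}_b(X)\to L^\infty(\mu)$ with $D(fg)=fDg+gDf$ that is weak* continuous (if $f_n\to f$ weak* then $\int h\,Df_n\,d\mu\to\int h\,Df\,d\mu$ for all $h\in L^1(\mu)$). Derivations form an $L^\infty(\mu)$-module $\mathscr X(\mu)$, and $\mathscr X(\mu\llcorner U)$ is the corresponding module for $\mu\llcorner U$. $\mathscr X(\mu\llcorner U)$ has index $\le N$ if any linearly independent (over $L^\infty(\mu\llcorner U)$) set of derivations in it has cardinality at most $N$. $\mathscr X(\mu)$ has index locally bounded by $N$ if $\mathscr X(\mu\llcorner U)$ has index $\le N$ for every $\mu$-measurable $U$ with $\mu(U)>0$. *)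

(* Defs.v *)
From HB Require Import structures.
From mathcomp Require Import all_boot all_order all_algebra.
From mathcomp Require Import all_classical all_reals all_analysis.

Set Implicit Arguments.
Unset Strict Implicit.
Unset Printing Implicit Defensive.

Import Order.TTheory GRing.Theory Num.Theory.
Import numFieldNormedType.Exports.

Local Open Scope classical_set_scope.
Local Open Scope ring_scope.

Section assouad_dimension.
Context {R : realType} (X : metricType R).

(* [diam set0] is [-oo] rather than 0; it is only compared with positive
   numbers below. *)
Definition diam (A : set X) : \bar R :=
  ereal_sup [set (mdist x y)%:E | x in A & y in A].

Definition assouad_exponent (D : R) : Prop :=
  exists C : R, forall eps r : R, 0 < eps < 1 -> 0 < r ->
    forall A : set X, (diam A <= r%:E)%E ->
    exists (n : nat) (B : 'I_n -> set X),
      [/\ n%:R <= C * eps `^ (- D),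
          forall i, (diam (B i) <= (eps * r)%:E)%E &
          A `<=` \bigcup_i B i].

Definition assouad_dim : \bar R :=
  ereal_inf [set D%:E | D in assouad_exponent].

End assouad_dimension.

Section bounded_lipschitz.
Context {R : realType} (X : metricType R).

Definition lipschitz_fun (f : X -> R) : Prop :=
  exists K : R, forall x y, `|f x - f y| <= K * mdist x y.

Definition lipb_pred : {pred X -> R} :=
  mem [set f : X -> R | bounded_fun f /\ lipschitz_fun f].

Record lipb := Lipb { lipb_val :> X -> R ; lipb_valP : lipb_val \in lipb_pred }.

HB.instance Definition _ := [isSub for lipb_val].
HB.instance Definition _ := [Choice of lipb by <:].

Lemma lipb_predP (f : X -> R) : f \in lipb_pred <->
  exists M K : R, [/\ 0 <= M, 0 <= K, forall x, `|f x| <= M &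
    forall x y, `|f x - f y| <= K * mdist x y].
Proof.
rewrite inE /=; split => [[[M [_ fM]] [K fK]]|[M [K [M0 K0 fM fK]]]].
  exists (Num.max 0 (M + 1)), (Num.max 0 K); split.
  - by rewrite le_max lexx.
  - by rewrite le_max lexx.
  - move=> x; rewrite le_max; apply/orP; right.
    by apply: fM => //; rewrite ltrDl.
  - move=> x y; apply: (le_trans (fK x y)).
    by rewrite ler_wpM2r ?mdist_ge0// le_max lexx orbT.
split; last by exists K.
exists M; split; first by rewrite realE M0.
by move=> N MN x _ /=; apply: (le_trans (fM x)); exact: ltW.
Qed.

Lemma lipb_cst1 : 1 \in lipb_pred.
Proof.
apply/lipb_predP; exists 1, 0; split => // x; first by rewrite normr1.
by move=> y; rewrite subrr normr0 mul0r.
Qed.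

Lemma lipb_linear_closed : linear_closed lipb_pred.
Proof.
move=> a f g /lipb_predP[M [K [M0 K0 fM fK]]] /lipb_predP[N [L [N0 L0 gN gL]]].
apply/lipb_predP; exists (`|a| * M + N), (`|a| * K + L).
split; rewrite ?addr_ge0 ?mulr_ge0// => x.
  apply: (le_trans (ler_normD _ _)); apply: lerD => //.
  by rewrite normrM ler_wpM2l.
move=> y; rewrite (_ : (a *: f + g) x - (a *: f + g) y =
  a * (f x - f y) + (g x - g y)); last by rewrite mulrBr opprD addrACA.
apply: (le_trans (ler_normD _ _)); rewrite mulrDl; apply: lerD => //.
by rewrite normrM -mulrA ler_wpM2l.
Qed.

Lemma lipb_mulr_2closed : GRing.mulr_2closed lipb_pred.
Proof.
move=> f g /lipb_predP[M [K [M0 K0 fM fK]]] /lipb_predP[N [L [N0 L0 gN gL]]].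
apply/lipb_predP; exists (M * N), (M * L + K * N).
split; rewrite ?addr_ge0 ?mulr_ge0// => x.
  by rewrite normrM ler_pM.
move=> y; rewrite (_ : (f * g) x - (f * g) y =
  f x * (g x - g y) + (f x - f y) * g y); last first.
  by rewrite mulrBr mulrBl addrA subrK.
apply: (le_trans (ler_normD _ _)); rewrite [leRHS]mulrDl !normrM; apply: lerD.
  by rewrite -mulrA ler_pM.
by rewrite mulrAC ler_pM.
Qed.

Lemma lipb_submod_closed : submod_closed lipb_pred.
Proof.
split; last exact: lipb_linear_closed.
by rewrite -(subrr 1) addrC -scaleN1r; apply: lipb_linear_closed lipb_cst1 lipb_cst1.
Qed.

Lemma lipb_subring_closed : subring_closed lipb_pred.
Proof.
split; [exact: lipb_cst1 | | exact: lipb_mulr_2closed].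
move=> f g fB gB; rewrite addrC -scaleN1r; exact: lipb_linear_closed.
Qed.

HB.instance Definition _ :=
  GRing.isSubmodClosed.Build R (X -> R) lipb_pred lipb_submod_closed.
HB.instance Definition _ :=
  GRing.isSubringClosed.Build (X -> R) lipb_pred lipb_subring_closed.
HB.instance Definition _ :=
  GRing.SubChoice_isSubComPzRing.Build _ _ lipb (subringClosedP lipb_pred).
HB.instance Definition _ := [SubZmodule_isSubLmodule of lipb by <:].

Definition lip_const (f : X -> R) : R :=
  sup [set `|f z.1 - f z.2| / mdist z.1 z.2 | z in [set z | z.1 != z.2]].

Definition lipb_norm (f : lipb) : R :=
  Num.max (sup (range (fun x => `|f x|))) (lip_const f).

(* Sequential weak* convergence for [lipb] as a dual Banach space. *)
Definition weak_star_cvg (u : nat -> lipb) (f : lipb) : Prop :=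
  (forall x, u n x @[n --> \oo] --> f x) /\
  exists M : R, forall n, lipb_norm (u n) <= M.

End bounded_lipschitz.

(* The two structures are not assumed to be compatible; that open sets are
   measurable is part of [radon_measure]. *)
#[short(type="measurableMetricType")]
HB.structure Definition MeasurableMetric (d : measure_display) (R : realType) :=
  {X of Measurable d X & Metric R X}.

(* The sigma-algebra carrying [mu] may be any one containing the Borel sets, so
   that it can be the Borel sigma-algebra or that of all mu-measurable sets
   (on a separable [X], inner regularity allows nothing larger). *)
Record radon_measure d (R : realType) (X : measurableMetricType d R)
    (mu : {measure set X -> \bar R}) : Prop := {
  radon_borel : forall A : set X, open A -> measurable A ;
  radon_locally_finite : forall x : X,
    exists A : set X, [/\ open A, A x & (mu A < +oo)%E] ;
  radon_inner_regular : forall A : set X, measurable A ->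
    mu A = ereal_sup [set mu K | K in [set K | compact K /\ K `<=` A]] }.

Notation Linfty mu := (LspaceType mu (leey 1)).

Section derivations.
Context {d} {R : realType} {X : measurableMetricType d R}.
Variable mu : {measure set X -> \bar R}.

Record derivation := Derivation {
  der_fun :> lipb X -> Linfty mu ;
  der_linear : forall (a : R) (f g : lipb X),
    der_fun (a *: f + g) = (fun x => a * der_fun f x + der_fun g x) %[ae mu] ;
  der_bounded : exists C : R, forall f : lipb X,
    ('N[mu]_+oo[EFin \o der_fun f] <= (C * lipb_norm f)%:E)%E ;
  der_leibniz : forall f g : lipb X,
    der_fun (f * g) =
      (fun x => f x * der_fun g x + g x * der_fun f x) %[ae mu] ;
  der_weak_star_continuous : forall (u : nat -> lipb X) (f : lipb X),
    weak_star_cvg u f ->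
    forall h : X -> R, mu.-integrable setT (EFin \o h) ->
      \int[mu]_x (h x * der_fun (u n) x) @[n --> \oo] -->
        \int[mu]_x (h x * der_fun f x) }.

(* Linear independence over the ring [Linfty mu] in the module of derivations,
   where (lambda D) f := lambda (D f). *)
Definition linearly_independent (S : set derivation) : Prop :=
  forall (n : nat) (D : 'I_n -> derivation) (lambda : 'I_n -> Linfty mu),
    injective D -> (forall i, S (D i)) ->
    (forall f : lipb X,
      (fun x => \sum_(i < n) lambda i x * D i f x) = cst 0 %[ae mu]) ->
    forall i, (lambda i : X -> R) = cst 0 %[ae mu].

Definition index_le (N : R) : Prop :=
  forall S : set derivation, linearly_independent S ->
    exists2 n : nat, (S #= `I_n)%card & n%:R <= N.

End derivations.

Definition index_locally_bounded d (R : realType)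
    (X : measurableMetricType d R) (mu : {measure set X -> \bar R}) (N : R) :
    Prop :=
  forall (U : set X) (mU : measurable U), (0 < mu U)%E ->
    index_le (mrestr mu mU) N.

(* Main.v *)
From HB Require Import structures.
Require Import Defs.
From mathcomp Require Import all_boot all_order all_algebra.
From mathcomp Require Import finmap all_classical all_reals all_analysis.
From mathcomp Require Import measurable_realfun ess_sup_inf ring lra.

Set Implicit Arguments.
Unset Strict Implicit.
Unset Printing Implicit Defensive.

Import Order.TTheory GRing.Theory Num.Theory.
Import numFieldNormedType.Exports.

Local Open Scope classical_set_scope.
Local Open Scope ring_scope.

(** Let [s] be an Assouad exponent of [X], and let [n] derivations be linearly
    independent over [Linfty]; the claim is [n <= s].

    Linear algebra over [Linfty] provides bounded Lipschitz functions [g_j] whose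
    Jacobian [det (D_i g_j)] is nonzero on a set of positive measure
    ([exists_jacobian]). On a compact subset [K0] where it is bounded away from
    [0], Cramer's rule turns the derivations into operators [T_i], still weak*
    continuous derivations, with [T_i g_j] equal to [1] if [i = j] and to [0]
    otherwise ([independent_card_le]). The map [g] into [R^n] now makes [X] at
    least [n]-dimensional at small scales, for the following reason.

    Fix a coordinate [i] and a scale [r], and let [z x] be the infimum of the costs of
    finite chains of points starting at [x] ([chain_fun]). Steps are charged for
    the variation of the other coordinates, for leaving a given subset [K] of
    [K0], and, at a small rate, for their length, but not for the variation of
    [g_i]; costs are damped exponentially as [g_i] decreases by multiples of [r].
    The function [z] lies between [0] and [1], [r z] is uniformly Lipschitz, and
    to first order [r z + z(x0) g_i] varies on [K] near [x0] only through the
    other coordinates, which [T_i] annihilates, and at the small rate. Therefore [T_i (r z)] is on [K] at most [- z] plus a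
    small constant ([cone_condition_le], [chain_fun_deriv_le]). Cutting [z] at a
    threshold gives functions [r * max (z - threshold) 0] tending weak* to [0]
    with [r], whose derivative is nonpositive on [K] and uniformly negative on the
    part of [K] where the threshold is exceeded. If [K] varies with [r] and fills
    [K0] in measure, the measure of that part tends to [0] ([vanishing_stuck]).

    A point where [z] is below the threshold starts a cheap chain, and following
    it until [g_i] has dropped by [r] reaches a point at distance [O(r)] whose
    other coordinates have hardly changed ([chain_move]). The endpoint lies in
    [K], the complement of which was only assumed small, so such moves can be
    iterated any fixed number of times once [r] is small ([iter_good_nonempty]).
    From one point they reach, within distance [O(m r)], points over all of an
    [m * ... * m] grid of mesh [r]; these [m ^ n] points are [r / 2]-separated.
    The constant in [O(m r)] depends only on the norms of the [T_i], not on [m]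
    or on the accuracy of the moves. Hence [m ^ n <= C (c m) ^ s] for every
    [m > 0], and [n <= s] ([card_le_assouad_exponent]). *)

(** * Bounded Lipschitz functions *)

Section bounded_lipschitz_functions.
Context {R : realType} {X : metricType R}.
Implicit Types (f g : X -> R) (x y : X).

(** One constant for both bounds; exchanging [x] and [y] makes the second one
    two-sided. *)
Definition bdlip (M : R) f : Prop :=
  (forall x, `|f x| <= M) /\ (forall x y, f x - f y <= M * mdist x y).

Lemma bdlip_normB M f x y : bdlip M f -> `|f x - f y| <= M * mdist x y.
Proof.
move=> [_ fM]; rewrite ler_norml fM andbT.
by have := fM y x; rewrite metric_sym; lra.
Qed.

Lemma bdlip_le M N f : M <= N -> bdlip M f -> bdlip N f.
Proof.
move=> MN [fM fL]; split=> [x|x y]; first exact: le_trans (fM x) MN.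
by apply: le_trans (fL x y) _; rewrite ler_wpM2r ?mdist_ge0.
Qed.

Lemma bdlip_ge0 M f x : bdlip M f -> 0 <= M.
Proof. by move=> [fM _]; exact: le_trans (fM x). Qed.

Lemma bdlip_cst c : bdlip `|c| (fun=> c).
Proof. by split=> // x y; rewrite subrr mulr_ge0 ?mdist_ge0. Qed.

Lemma bdlipD M N f g : bdlip M f -> bdlip N g -> bdlip (M + N) (fun x => f x + g x).
Proof.
move=> [fM fL] [gM gL]; split=> [x|x y].
  by apply: le_trans (ler_normD _ _) _; apply: lerD.
by have := fL x y; have := gL x y; rewrite mulrDl; lra.
Qed.

Lemma bdlipZ M a f : bdlip M f -> bdlip (`|a| * M) (fun x => a * f x).
Proof.
move=> fM; split=> [x|x y]; first by rewrite normrM ler_wpM2l// (proj1 fM).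
rewrite -mulrBr (le_trans (ler_norm _))// normrM -mulrA ler_wpM2l//.
exact: bdlip_normB.
Qed.

Lemma bdlipN M f : bdlip M f -> bdlip M (fun x => - f x).
Proof.
move=> [fM fL]; split=> [x|x y]; first by rewrite normrN.
by have := fL y x; rewrite metric_sym; lra.
Qed.

Lemma bdlipM M N f g : bdlip M f -> bdlip N g ->
  bdlip (2 * (M * N)) (fun x => f x * g x).
Proof.
move=> fM gN; have [fb fL] := fM; have [gb gL] := gN; split=> [x|x y].
  have M0 := bdlip_ge0 x fM; have N0 := bdlip_ge0 x gN.
  rewrite normrM; apply: (@le_trans _ _ (M * N)); first exact: ler_pM.
  by rewrite ler_peMl ?mulr_ge0// ler1n.
have -> : f x * g x - f y * g y = f x * (g x - g y) + g y * (f x - f y) by ring.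
have -> : 2 * (M * N) * mdist x y =
  M * (N * mdist x y) + N * (M * mdist x y) by ring.
apply: lerD; apply: le_trans (ler_norm _) _; rewrite normrM ler_pM//;
  exact: bdlip_normB.
Qed.

Lemma bdlip_min M f g : bdlip M f -> bdlip M g ->
  bdlip M (fun x => Num.min (f x) (g x)).
Proof.
move=> [fM fL] [gM gL]; split=> [x|x y]; first by case: (leP (f x)).
have := fL x y; have := gL x y.
by case: (leP (f x)); case: (leP (f y)); lra.
Qed.

Lemma bdlip_max M f g : bdlip M f -> bdlip M g ->
  bdlip M (fun x => Num.max (f x) (g x)).
Proof.
move=> [fM fL] [gM gL]; split=> [x|x y]; first by case: (leP (f x)).
have := fL x y; have := gL x y.
by case: (leP (f x)); case: (leP (f y)); lra.
Qed.

Lemma bdlip_normr M f : bdlip M f -> bdlip M (fun x => `|f x|).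
Proof.
move=> fM; split=> [x|x y]; first by rewrite normr_id (proj1 fM).
by apply: le_trans (lerB_dist _ _) _; apply: bdlip_normB.
Qed.

Lemma bdlip_mdist1 y : bdlip 1 (fun x => Num.min (mdist x y) 1).
Proof.
split=> [x|x z].
  rewrite ger0_norm ?le_min ?mdist_ge0 ?ler01//.
  by rewrite ge_min lexx orbT.
rewrite mul1r; have := metric_triangle x z y; have := mdist_ge0 x z.
by case: (leP (mdist x y) 1); case: (leP (mdist z y) 1); lra.
Qed.

Lemma bdlip_continuous M f : bdlip M f -> continuous f.
Proof.
move=> fM x; apply/cvgrPdist_lt => e e0.
have M0 := bdlip_ge0 x fM; have M1 : 0 < M + 1 by lra.
apply/metricType_numDomainType.nbhs_mdistP.
exists (e / (M + 1)) => [|y /= xy]; first by rewrite /= divr_gt0.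
apply: le_lt_trans (bdlip_normB _ _ fM) _.
apply: (@le_lt_trans _ _ ((M + 1) * mdist x y)).
  by rewrite ler_wpM2r ?mdist_ge0//; lra.
by rewrite mulrC -ltr_pdivlMr.
Qed.

End bounded_lipschitz_functions.

(** * Weak* continuous derivations acting on functions *)

Section operators.
Context {d} {R : realType} {X : measurableMetricType d R}.
Variable nu : {measure set X -> \bar R}.
Hypothesis borel : forall A : set X, open A -> measurable A.
Implicit Types (f g : X -> R) (E : set X).

(** The pointwise bound, instead of an almost everywhere one, makes the values
    integrable on sets of finite measure. These operators are stable under
    multiplication by bounded measurable functions. *)
Record der_op (T : (X -> R) -> X -> R) (C : R) : Prop := {
  der_op_measurable : forall M f, bdlip M f -> measurable_fun setT (T f) ;
  der_op_bounded : forall M f x, bdlip M f -> `|T f x| <= C * M ;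
  der_opD : forall M f g, bdlip M f -> bdlip M g ->
    \forall x \ae nu, T (fun y => f y + g y) x = T f x + T g x ;
  der_opZ : forall M a f, bdlip M f ->
    \forall x \ae nu, T (fun y => a * f y) x = a * T f x ;
  der_opM : forall M f g, bdlip M f -> bdlip M g ->
    \forall x \ae nu, T (fun y => f y * g y) x = f x * T g x + g x * T f x ;
  der_op_cvg : forall M (u : nat -> X -> R) f,
    (forall n, bdlip M (u n)) -> bdlip M f ->
    (forall x, u n x @[n --> \oo] --> f x) ->
    forall h : X -> R, nu.-integrable setT (EFin \o h) ->
    \int[nu]_x (h x * T (u n) x) @[n --> \oo] --> \int[nu]_x (h x * T f x) }.

Lemma measurable_closed_set (A : set X) : closed A -> measurable A.
Proof. by move=> cA; rewrite -(setCK A); apply/measurableC/borel/closed_openC. Qed.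

Lemma bdlip_measurable_lt M f (c : R) : bdlip M f -> measurable [set x | f x < c].
Proof.
move=> fM; apply: borel; apply: (@open_comp _ _ f [set y | y < c]).
  by move=> x _; exact: bdlip_continuous fM x.
exact: open_lt.
Qed.

Variables (T : (X -> R) -> X -> R) (C : R).
Hypothesis derT : der_op T C.

Lemma Rintegral_indic E f : \int[nu]_x (\1_E x * f x) = \int[nu]_(x in E) f x.
Proof.
rewrite [RHS]Rintegral_mkcond; apply: eq_Rintegral => x _.
by rewrite patchE indicE; case: (x \in E); rewrite ?mul1r ?mul0r.
Qed.

Lemma le_Rintegral_ae E f g : measurable E ->
  nu.-integrable E (EFin \o f) -> nu.-integrable E (EFin \o g) ->
  (\forall x \ae nu, E x -> f x <= g x) ->
  \int[nu]_(x in E) f x <= \int[nu]_(x in E) g x.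
Proof.
move=> mE fi gi [N [mN N0 subN]]; rewrite /Rintegral.
rewrite (negligible_integral mN mE fi N0) (negligible_integral mN mE gi N0).
have mEN := measurableD mE mN.
have fi' := integrableS mE mEN (@subDsetl _ _ _) fi.
have gi' := integrableS mE mEN (@subDsetl _ _ _) gi.
apply: le_Rintegral => // x [Ex nNx].
by apply: contrapT => nle; apply: nNx; apply: subN => /= /(_ Ex).
Qed.

Lemma der_op_integrable E M f : measurable E -> (nu E < +oo)%E -> bdlip M f ->
  nu.-integrable E (EFin \o T f).
Proof.
move=> mE Efin fM; apply: measurable_bounded_integrable => //.
  exact: measurable_funTS (der_op_measurable derT fM).
exists (C * M); split; first exact: num_real.
by move=> N ltN x _; apply: le_trans (der_op_bounded derT x fM) (ltW ltN).
Qed.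

Lemma der_op_cvg_in E M (u : nat -> X -> R) f : measurable E -> (nu E < +oo)%E ->
  (forall n, bdlip M (u n)) -> bdlip M f ->
  (forall x, u n x @[n --> \oo] --> f x) ->
  \int[nu]_(x in E) T (u n) x @[n --> \oo] --> \int[nu]_(x in E) T f x.
Proof.
move=> mE Efin uM fM uf.
have h1 : nu.-integrable setT (EFin \o \1_E).
  apply/integrableP; split; first exact/measurable_EFinP/measurable_indic.
  under eq_integral => x _ do rewrite /= ger0_norm//.
  by rewrite integral_indic// setIT.
have := der_op_cvg derT uM fM uf h1.
under eq_fun do rewrite Rintegral_indic.
by rewrite Rintegral_indic.
Qed.

(** Testing weak* convergence on the part of [E] where the limit exceeds the
    bound shows that this part is null. *)
Lemma der_op_limit_le E M (u : nat -> X -> R) f c :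
  measurable E -> (nu E < +oo)%E ->
  (forall n, bdlip M (u n)) -> bdlip M f ->
  (forall x, u n x @[n --> \oo] --> f x) ->
  (forall n, \forall x \ae nu, E x -> T (u n) x <= c) ->
  \forall x \ae nu, E x -> T f x <= c.
Proof.
move=> mE Efin uM fM uf uc.
pose E' := E `&` [set x | c < T f x].
have mE' : measurable E'.
  rewrite /E'; apply: measurableI => //.
  have := measurable_fun_ltr (measurable_cst c) (der_op_measurable derT fM).
  by move=> /(_ measurableT [set true]); rewrite setTI; apply.
have E'fin : (nu E' < +oo)%E.
  by apply: le_lt_trans Efin; apply: le_measure; rewrite ?inE//; apply: subIsetl.
have intu n := der_op_integrable mE' E'fin (uM n).
have intf := der_op_integrable mE' E'fin fM.
have intc : nu.-integrable E' (EFin \o cst c).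
  apply: measurable_bounded_integrable => //; exact: bounded_cst.
have le_n n : \int[nu]_(x in E') T (u n) x <= \int[nu]_(x in E') c.
  apply: le_Rintegral_ae => //; apply: filterS (uc n) => x ucx [Ex _].
  exact: ucx.
have le_lim : \int[nu]_(x in E') T f x <= \int[nu]_(x in E') c.
  apply: (cvgr_to_le (der_op_cvg_in mE' E'fin uM fM uf)).
  exact: nearW.
have intfc : nu.-integrable E' (EFin \o (fun x => T f x - c)).
  by have := integrableB mE' intf intc.
have int0 : (\int[nu]_(x in E') `|(T f x - c)%:E| = 0)%E.
  rewrite (eq_integral (fun x => (T f x - c)%:E)); last first.
    move=> x /set_mem[_ /= cx]; rewrite ger0_norm//; lra.
  rewrite -[LHS]fineK; last exact: integrable_fin_num.
  congr EFin; apply/eqP; rewrite eq_le; apply/andP; split.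
    by rewrite -/(Rintegral nu E' _) RintegralB// subr_le0.
  by apply: Rintegral_ge0 => x [_ /= cx]; lra.
move/(ae_eq_integral_abs nu mE') : int0.
have /integrableP[mfc _] := intfc.
move=> /(_ mfc); apply: filterS => x /= E'x Ex; rewrite leNgt; apply/negP => cx.
have /eqP := E'x (conj Ex cx); rewrite eqe subr_eq0 => /eqP Tc.
by rewrite Tc ltxx in cx.
Qed.

Lemma der_opN M f : bdlip M f ->
  \forall x \ae nu, T (fun y => - f y) x = - T f x.
Proof.
move=> fM; have := der_opZ derT (-1) fM.
have -> : (fun y => -1 * f y) = (fun y => - f y).
  by apply/funext => y; rewrite mulN1r.
by apply: filterS => x ->; rewrite mulN1r.
Qed.

Lemma der_op_limit_norm_le E M (u : nat -> X -> R) f c :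
  measurable E -> (nu E < +oo)%E ->
  (forall n, bdlip M (u n)) -> bdlip M f ->
  (forall x, u n x @[n --> \oo] --> f x) ->
  (forall n, \forall x \ae nu, E x -> `|T (u n) x| <= c) ->
  \forall x \ae nu, E x -> `|T f x| <= c.
Proof.
move=> mE Efin uM fM uf uc.
have le1 : \forall x \ae nu, E x -> T f x <= c.
  apply: (der_op_limit_le mE Efin uM fM uf) => n.
  by apply: filterS (uc n) => x ucx Ex; apply: le_trans (ler_norm _) (ucx Ex).
have le2 : \forall x \ae nu, E x -> T (fun y => - f y) x <= c.
  apply: (der_op_limit_le mE Efin (fun n => bdlipN (uM n)) (bdlipN fM)).
    by move=> x; apply: cvgN.
  move=> n; apply: filterS2 (uc n) (der_opN (uM n)) => x ucx -> Ex.
  by case/ler_normlP : (ucx Ex).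
have := der_opN fM; apply: filterS3 le1 le2 => x le1 le2 eN Ex.
by apply/ler_normlP; split; [rewrite -eN; exact: le2 | exact: le1].
Qed.

Lemma der_op_cst c : \forall x \ae nu, T (fun=> c) x = 0.
Proof.
have b1 : bdlip 1 (fun _ : X => 1 : R) by have := bdlip_cst (X := X) (1 : R); rewrite normr1.
have := der_opM derT b1 b1; have := der_opZ derT c b1.
rewrite mulr1; have -> : (fun=> 1 * 1) = (fun=> 1) :> (X -> R).
  by apply/funext => y; rewrite mulr1.
apply: filterS2 => x -> e1.
have -> : T (fun=> 1) x = 0 by lra.
by rewrite mulr0.
Qed.

Lemma cvg_le_harmonic (u : nat -> R) (l K : R) :
  (forall n, `|u n - l| <= K * n.+1%:R^-1) -> u n @[n --> \oo] --> l.
Proof.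
move=> uK.
have K0 : K * n.+1%:R^-1 @[n --> \oo] --> (0 : R).
  by rewrite -(mulr0 K); apply: cvgMr; exact: cvg_harmonic.
have lo : l - K * n.+1%:R^-1 @[n --> \oo] --> l.
  by rewrite -[X in _ --> X]subr0; apply: cvgB => //; exact: cvg_cst.
have hi : l + K * n.+1%:R^-1 @[n --> \oo] --> l.
  by rewrite -[X in _ --> X]addr0; apply: cvgD => //; exact: cvg_cst.
apply: (squeeze_cvgr _ lo hi); apply: nearW => n.
by rewrite -ler_distl; exact: uK.
Qed.

(** Shrinking the values of [f] towards [0] by [e] gives a function [f_e] which
    equals its product with [min 1 (|f| / e)]; both factors vanish where [f]
    does, so the Leibniz rule gives [T f_e = 0] there, and [f_e] tends to [f]. *)
Lemma der_op_local0 E M f : measurable E -> (nu E < +oo)%E -> bdlip M f ->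
  (forall x, E x -> f x = 0) -> \forall x \ae nu, E x -> T f x = 0.
Proof.
move=> mE Efin fM f0.
have [[x0 _]|X0] := pselect (exists x : X, True); last first.
  by apply: aeW => x; exfalso; apply: X0; exists x.
have M0 := bdlip_ge0 x0 fM.
pose e n : R := n.+1%:R^-1.
have e0 n : 0 < e n by rewrite invr_gt0.
have e1 n : e n <= 1 by rewrite invf_le1// ler1n.
pose clamp n x := Num.max (Num.min (f x) (e n)) (- e n).
pose u n x := f x + - clamp n x.
pose psi n x := Num.min ((e n)^-1 * `|f x|) 1.
have fM1 : bdlip (M + 1) f by apply: bdlip_le fM; lra.
have cM n (c : R) : `|c| <= 1 -> bdlip (M + 1) (fun _ : X => c).
  by move=> c1; apply: bdlip_le (bdlip_cst c); lra.
have clampM n : bdlip (M + 1) (clamp n).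
  apply: bdlip_max; last by apply: cM => //; rewrite normrN gtr0_norm.
  by apply: bdlip_min => //; apply: cM => //; rewrite gtr0_norm.
have uM n : bdlip (M + 1 + (M + 1)) (u n) by apply: bdlipD => //; exact: bdlipN.
have fM2 : bdlip (M + 1 + (M + 1)) f by apply: bdlip_le fM; lra.
have psiM n : bdlip (`|(e n)^-1| * M + 1) (psi n).
  have eM : 0 <= `|(e n)^-1| * M by apply: mulr_ge0.
  apply: bdlip_min.
    by apply: (@bdlip_le _ _ (`|(e n)^-1| * M)); [lra | apply/bdlipZ/bdlip_normr].
  by apply: bdlip_le (bdlip_cst 1); rewrite normr1; lra.
have psiE n x : `|f x| < e n \/ psi n x = 1.
  rewrite /psi.
  have [fe|fe] := ltP `|f x| (e n); [by left|right].
  by rewrite min_r// mulrC ler_pdivlMr// mul1r.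
have uE n x : `|f x| < e n -> u n x = 0.
  rewrite /u /clamp ltr_norml => /andP[f1 f2].
  by rewrite min_l ?max_l ?ltW// subrr.
have upsi n : (fun x => u n x * psi n x) = u n.
  apply/funext => x; have [/uE->|->] := psiE n x; first by rewrite mul0r.
  by rewrite mulr1.
have Tu n : \forall x \ae nu, E x -> `|T (u n) x| <= 0.
  have := der_opM derT (bdlip_le _ (uM n)) (bdlip_le _ (psiM n)).
  move=> /(_ (M + 1 + (M + 1) + (`|(e n)^-1| * M + 1))).
  have ? : 0 <= `|(e n)^-1| * M by apply: mulr_ge0.
  rewrite upsi => H; apply: filterS (H _ _) => [x -> Ex||]; [|lra..].
  by rewrite uE ?f0 ?normr0// /psi f0// normr0 mulr0 min_l// !mul0r addr0 normr0.
have uf x : u n x @[n --> \oo] --> f x.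
  apply: (@cvg_le_harmonic _ _ 1) => n; rewrite mul1r -/(e n) /u addrAC subrr add0r.
  rewrite normrN ler_norml; rewrite /clamp le_max lexx orbT/= ge_max.
  by rewrite ge_min lexx orbT/=; have := e0 n; lra.
have := der_op_limit_norm_le mE Efin uM fM2 uf Tu.
by apply: filterS => x + Ex; move/(_ Ex); rewrite normr_le0 => /eqP.
Qed.

(** Locality: the derivative on [E] depends only on the values on [E]. *)
Lemma der_op_local E M f g : measurable E -> (nu E < +oo)%E ->
  bdlip M f -> bdlip M g ->
  (forall x, E x -> f x = g x) -> \forall x \ae nu, E x -> T f x = T g x.
Proof.
move=> mE Efin fM gM fg.
have fg0 x : E x -> f x + - g x = 0 by move=> /fg ->; rewrite subrr.
have H := der_op_local0 mE Efin (bdlipD fM (bdlipN gM)) fg0.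
have HD := der_opD derT fM (bdlipN gM); have HN := der_opN gM.
apply: filterS3 H HD HN => x fgx fgD gN Ex.
by apply/eqP; rewrite -subr_eq0 -gN -fgD fgx.
Qed.

(** The minimum coincides with one of the two functions on each of two measurable
    sets, so this is an instance of locality. *)
Lemma der_op_min_norm_le E M f g c : measurable E -> (nu E < +oo)%E ->
  bdlip M f -> bdlip M g ->
  (\forall x \ae nu, E x -> `|T f x| <= c) ->
  (\forall x \ae nu, E x -> `|T g x| <= c) ->
  \forall x \ae nu, E x -> `|T (fun y => Num.min (f y) (g y)) x| <= c.
Proof.
move=> mE Efin fM gM fc gc.
set m := fun y => Num.min (f y) (g y).
have minM : bdlip M m := bdlip_min fM gM.
pose E1 := E `&` [set x | f x - g x < 0]; pose E2 := E `\` [set x | f x - g x < 0].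
have mlt : measurable [set x | f x - g x < 0].
  exact: bdlip_measurable_lt (bdlipD fM (bdlipN gM)).
have mE1 : measurable E1 by exact: measurableI.
have mE2 : measurable E2 by exact: measurableD.
have fin A : measurable A -> A `<=` E -> (nu A < +oo)%E.
  by move=> mA AE; apply: le_lt_trans Efin; apply: le_measure; rewrite ?inE.
have E1f := @der_op_local _ _ _ _ mE1 (fin _ mE1 (@subIsetl _ _ _)) minM fM.
have E2g := @der_op_local _ _ _ _ mE2 (fin _ mE2 (@subDsetl _ _ _)) minM gM.
have {}E1f : \forall x \ae nu, E1 x -> T m x = T f x.
  by apply: E1f => x [_ /= fg]; rewrite /m min_l//; lra.
have {}E2g : \forall x \ae nu, E2 x -> T m x = T g x.
  by apply: E2g => x [_ /= /negP fg]; rewrite /m min_r//; move: fg; rewrite -leNgt; lra.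
near=> x => Ex.
have fcx : E x -> `|T f x| <= c by near: x.
have gcx : E x -> `|T g x| <= c by near: x.
have E1x : E1 x -> T m x = T f x by near: x.
have E2x : E2 x -> T m x = T g x by near: x.
have [fg|fg] := pselect (f x - g x < 0); first by rewrite E1x //; exact: fcx.
by rewrite E2x //; exact: gcx.
Unshelve. all: by end_near. Qed.

End operators.

(** * Functions controlled by coordinates of zero derivative *)

Section cones.
Context {d} {R : realType} {X : measurableMetricType d R}.
Variable nu : {measure set X -> \bar R}.
Hypothesis borel : forall A : set X, open A -> measurable A.
Variables (T : (X -> R) -> X -> R) (C : R).
Hypothesis derT : der_op nu T C.
Variable E : set X.
Hypotheses (mE : measurable E) (Efin : (nu E < +oo)%E).
Implicit Types (f g : X -> R).

Definition deriv_le (M c : R) f : Prop :=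
  bdlip M f /\ \forall x \ae nu, E x -> `|T f x| <= c.

Lemma deriv_le_le M N c e f : M <= N -> c <= e -> deriv_le M c f -> deriv_le N e f.
Proof.
move=> MN ce [fM fc]; split; first exact: bdlip_le fM.
by apply: filterS fc => x fc Ex; apply: le_trans ce; exact: fc.
Qed.

Lemma deriv_le_cst c : deriv_le `|c| 0 (fun=> c).
Proof.
split; first exact: bdlip_cst.
by apply: filterS (der_op_cst derT c) => x -> _; rewrite normr0.
Qed.

Lemma deriv_leD M N c e f g : 0 <= M -> 0 <= N -> deriv_le M c f -> deriv_le N e g ->
  deriv_le (M + N) (c + e) (fun x => f x + g x).
Proof.
move=> M0 N0 [fM fc] [gM ge]; split; first exact: bdlipD.
have fMN : bdlip (M + N) f by apply: bdlip_le fM; lra.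
have gMN : bdlip (M + N) g by apply: bdlip_le gM; lra.
have := der_opD derT fMN gMN; apply: filterS3 fc ge => x fc ge -> Ex.
by apply: le_trans (ler_normD _ _) _; apply: lerD; [exact: fc|exact: ge].
Qed.

Lemma deriv_leZ M c a f : deriv_le M c f -> deriv_le (`|a| * M) (`|a| * c) (fun x => a * f x).
Proof.
move=> [fM fc]; split; first exact: bdlipZ.
apply: filterS2 fc (der_opZ derT a fM) => x fc -> Ex.
by rewrite normrM ler_wpM2l// fc.
Qed.

Lemma deriv_le_min M c f g : deriv_le M c f -> deriv_le M c g ->
  deriv_le M c (fun x => Num.min (f x) (g x)).
Proof.
move=> [fM fc] [gM gc]; split; first exact: bdlip_min.
exact: (der_op_min_norm_le borel derT mE Efin fM gM fc gc).
Qed.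

Lemma deriv_leN M c f : deriv_le M c f -> deriv_le M c (fun x => - f x).
Proof.
move=> [fM fc]; split; first exact: bdlipN.
by apply: filterS2 fc (der_opN derT fM) => x fc -> Ex; rewrite normrN fc.
Qed.

Lemma deriv_le_normr M c f : deriv_le M c f -> deriv_le M c (fun x => `|f x|).
Proof.
move=> fs; have := deriv_leN (deriv_le_min fs (deriv_leN fs)).
congr deriv_le; apply/funext => x.
by case: (ger0P (f x)) => fx; [rewrite min_r ?opprK//|rewrite min_l//]; lra.
Qed.

Lemma deriv_le_sum (I : Type) (r : seq I) (P : pred I) (M : R) (h : I -> X -> R) :
  0 <= M -> (forall j, P j -> deriv_le M 0 (h j)) ->
  deriv_le (\sum_(j <- r | P j) M) 0 (fun x => \sum_(j <- r | P j) h j x).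
Proof.
move=> M0 hM; elim: r => [|i r IH].
  rewrite big_nil (_ : (fun=> _) = (fun=> 0)); last first.
    by apply/funext => x; rewrite big_nil.
  by have := deriv_le_cst 0; rewrite normr0.
rewrite big_cons; case: ifPn => Pi.
  rewrite (_ : (fun=> _) = (fun x => h i x + \sum_(j <- r | P j) h j x)).
    by rewrite -[X in deriv_le _ X]addr0; apply: deriv_leD => //; [exact: sumr_ge0|exact: hM].
  by apply/funext => x; rewrite big_cons Pi.
rewrite (_ : (fun=> _) = (fun x => \sum_(j <- r | P j) h j x))//.
by apply/funext => x; rewrite big_cons (negbTE Pi).
Qed.

Variables (I : finType) (P : pred I) (h : I -> X -> R) (M Mh A dl : R).
Variable f : X -> R.
Hypotheses (M0 : 0 <= M) (Mh0 : 0 <= Mh) (A0 : 0 <= A) (dl0 : 0 <= dl).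
Hypothesis hM : forall j, P j -> bdlip Mh (h j).
Hypothesis Th0 : forall j, P j -> \forall x \ae nu, E x -> T (h j) x = 0.
Hypothesis fM : bdlip M f.

(** The truncation of the distance keeps cones bounded; it has no effect on sets
    of diameter at most [1]. *)
Definition cone y x :=
  f y + (A * (\sum_(j | P j) `|h j x + - h j y|) + dl * Num.min (mdist x y) 1).

Let c := C * dl.
Let M1 := M + (A * (\sum_(j | P j) (Mh + Mh)) + dl).

Lemma cone_deriv_le y : deriv_le M1 c (cone y).
Proof.
rewrite /cone /M1 -[X in deriv_le _ X]add0r; apply: deriv_leD => //.
- by apply: addr_ge0 => //; apply: mulr_ge0 => //; apply: sumr_ge0 => j _; apply: addr_ge0.
- apply: deriv_le_le (deriv_le_cst (f y)) => //; exact: (proj1 fM).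
rewrite -[X in deriv_le _ X]add0r; apply: deriv_leD => //.
- by apply: mulr_ge0 => //; apply: sumr_ge0 => j _; apply: addr_ge0.
- rewrite -{1}(ger0_norm A0) -[X in deriv_le _ X](mulr0 `|A|); apply: deriv_leZ.
  apply: (@deriv_le_sum _ _ _ _ (fun j x => `|h j x + - h j y|)) => [|j Pj].
    exact: addr_ge0.
  apply: deriv_le_normr; rewrite -[X in deriv_le _ X]addr0; apply: deriv_leD => //.
    split; first exact: hM.
    by apply: filterS (Th0 Pj) => x + Ex; move=> /(_ Ex) ->; rewrite normr0.
  by apply: deriv_le_le (deriv_le_cst _) => //; rewrite normrN (proj1 (hM Pj)).
- have b1 := bdlip_mdist1 y.
  have := @deriv_leZ 1 C dl (fun x => Num.min (mdist x y) 1).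
  rewrite !(ger0_norm dl0) mulr1 (mulrC dl C); apply; split=> //.
  by apply: aeW => x _; have := der_op_bounded derT x b1; rewrite mulr1.
Qed.

Hypothesis C0 : 0 <= C.
Hypothesis diamE : forall x y, E x -> E y -> mdist x y <= 1.
Hypothesis fcone : forall x y, E x -> E y ->
  f x - f y <= A * (\sum_(j | P j) `|h j x - h j y|) + dl * mdist x y.

Lemma min_cones (s : seq X) : (forall y, y \in s -> E y) ->
  exists F, [/\ deriv_le M1 c F, forall x, E x -> f x <= F x &
    forall y, y \in s -> forall x, F x <= cone y x].
Proof.
elim: s => [_|y s IH sE].
  exists (fun=> M); split => [|x _|//].
    apply: deriv_le_le (deriv_le_cst M); rewrite ?ger0_norm ?/M1 ?/c ?mulr_ge0//.
    by rewrite lerDl addr_ge0// mulr_ge0// sumr_ge0// => j _; apply: addr_ge0.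
  by apply: le_trans (ler_norm _) (proj1 fM x).
have [|F [Fs fF Fcone]] := IH.
  by move=> z zs; apply: sE; rewrite inE zs orbT.
exists (fun x => Num.min (F x) (cone y x)); split.
- by apply: deriv_le_min => //; exact: cone_deriv_le.
- move=> x Ex; rewrite le_min fF//=.
  have Ey : E y by apply: sE; rewrite inE eqxx.
  by rewrite /cone min_l ?diamE//; have := fcone Ex Ey; lra.
- move=> z; rewrite inE => /predU1P[->|zs] x; first by rewrite ge_min lexx orbT.
  by rewrite ge_min Fcone.
Qed.

Hypothesis totbd : forall e : R, 0 < e -> exists2 s : seq X,
  (forall y, y \in s -> E y) & (forall x, E x -> exists2 y, y \in s & mdist x y < e).

(** [f] is, up to [O(e)], the minimum of the cones with vertices in a finite
    [e]-net of [E]. A cone has derivative at most [C dl] because the [h j] have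
    derivative [0], and the bound survives minima and weak* limits. The
    approximant is clamped to [f + O(e)] so that it converges off [E] too. *)
Lemma cone_condition_le : \forall x \ae nu, E x -> `|T f x| <= C * dl.
Proof.
pose K := M + (A * (\sum_(j | P j) Mh) + dl).
have K0 : 0 <= K.
  by rewrite /K !addr_ge0// mulr_ge0// sumr_ge0.
have [F0|] := pselect (forall n : nat, exists F, [/\ deriv_le M1 c F,
    forall x, E x -> f x <= F x & forall x, E x -> F x <= f x + K * n.+1%:R^-1]);
    last first.
  case=> n; have n0 : 0 < n.+1%:R^-1 :> R by rewrite invr_gt0.
  have [s sE sd] := totbd n0; have [F [Fs fF Fcone]] := min_cones sE.
  exists F; split => // x Ex; have [y ys xy] := sd x Ex.
  apply: le_trans (Fcone y ys x) _; rewrite /cone min_l ?diamE//; last exact: sE.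
  apply: (@le_trans _ _ (f x + K * mdist x y)); last first.
    by rewrite lerD2l ler_wpM2l// ltW.
  have -> : K * mdist x y = M * mdist x y +
      (A * (\sum_(j | P j) Mh * mdist x y) + dl * mdist x y).
    by rewrite /K -mulr_suml; ring.
  have := proj2 fM y x; rewrite metric_sym.
  have : \sum_(j | P j) `|h j x - h j y| <= \sum_(j | P j) Mh * mdist x y.
    by apply: ler_sum => j Pj; apply: bdlip_normB; exact: hM.
  by move=> /(ler_wpM2l A0); lra.
have [F Fp] := choice F0.
pose e n : R := K * n.+1%:R^-1.
have e0 n : 0 <= e n by rewrite mulr_ge0.
have eK n : e n <= K by rewrite /e ler_piMr// invf_le1// ler1n.
pose u n x := Num.max (Num.min (F n x) (f x + e n)) (f x + - e n).
have M10 : 0 <= M1.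
  by rewrite /M1 !addr_ge0// mulr_ge0// sumr_ge0// => j _; apply: addr_ge0.
pose M2 := M1 + (M + K).
have cM n b : `|b| = e n -> bdlip K (fun _ : X => b).
  by move=> bn; apply: bdlip_le (bdlip_cst b); rewrite bn.
have fM2 b n : `|b| = e n -> bdlip M2 (fun x => f x + b).
  move=> bn; apply: (@bdlip_le _ _ (M + K)); first by rewrite lerDr.
  by apply: bdlipD => //; exact: cM bn.
have FM2 n : bdlip M2 (F n).
  by have [[FM _] _ _] := Fp n; apply: bdlip_le FM; rewrite lerDl addr_ge0.
have uM n : bdlip M2 (u n).
  apply: bdlip_max; last by apply: (fM2 _ n); rewrite normrN ger0_norm.
  by apply: bdlip_min => //; apply: (fM2 _ n); rewrite ger0_norm.
apply: (der_op_limit_norm_le derT mE Efin uM).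
- by apply: bdlip_le fM; rewrite /M2 addrCA lerDl addr_ge0.
- move=> x; apply: (@cvg_le_harmonic _ _ _ K) => n; rewrite -/(e n) ler_distl /u.
  rewrite le_max lexx orbT/= ge_max ge_min lexx orbT/=.
  by have := e0 n; lra.
- move=> n; have [[FM Fc] fF Ff] := Fp n.
  have uF : forall x, E x -> u n x = F n x.
    move=> x Ex; rewrite /u min_l ?Ff// max_l//.
    by have := fF x Ex; have := e0 n; lra.
  have TuF := der_op_local derT mE Efin (uM n) (FM2 n) uF.
  by apply: filterS2 Fc TuF => x Fc uFx Ex; rewrite uFx//; exact: Fc.
Qed.

End cones.

(** * Chains at a given scale *)

Lemma expR_le_quadratic {R : realType} (a : R) : a <= 2^-1 ->
  expR a <= 1 + a + 2 * (a * a).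
Proof.
move=> a2; have a1 : 0 < 1 - a by lra.
have : 1 - a <= expR (- a) by exact: expR_ge1Dx.
rewrite expRN => le_inv.
have : expR a <= (1 - a)^-1 by rewrite -[expR a]invrK lef_pV2// posrE invr_gt0 expR_gt0.
move=> /le_trans; apply; rewrite -[X in X <= _]mul1r ler_pdivrMr//.
have : 0 <= (a * a) * (1 - 2 * a) by apply: mulr_ge0; [exact: sqr_ge0|lra].
by lra.
Qed.

Section chains.
Context {R : realType} {X : metricType R} {I : finType}.
Variables (g : I -> X -> R) (i : I) (K : set X) (r A dl : R).
Implicit Types (x y p q : X) (s : seq X).

(** A slope that dominates both kinds of steps, since the coordinates are
    [1]-Lipschitz. *)
Definition chain_slope : R := A * (#|I|%:R + 1).

Definition transverse x y : R := \sum_(j | j != i) `|g j x - g j y|.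

(** Inside [K], short steps pay at the high rate [A] for the transverse motion
    and at the low rate [dl] for their length; variation of [g i] is free. *)
Definition step_cost x y : R :=
  if `[< [/\ K x, K y & mdist x y <= r / A] >]
  then A * transverse x y + dl * mdist x y
  else chain_slope * mdist x y.

(** Because of the exponential weights, a chain cannot be cheap unless [g i]
    drops by about [r] along it. *)
Fixpoint chain_cost x s : R :=
  if s is y :: s' then
    step_cost x y / r + expR ((g i y - g i x) / r) * chain_cost y s'
  else 1.

Definition chain_fun x : R := inf (range (chain_cost x)).

Hypothesis gM : forall j, bdlip 1 (g j).
Hypotheses (r0 : 0 < r) (A1 : 1 <= A) (dl0 : 0 < dl) (dl1 : dl <= 1).

Local Notation L := chain_slope.
Local Notation z := chain_fun.

Let A0 : 0 < A. Proof. exact: lt_le_trans A1. Qed.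

Lemma g_lip j x y : `|g j x - g j y| <= mdist x y.
Proof. by rewrite -[leRHS]mul1r; exact: bdlip_normB. Qed.

Lemma chain_slope_ge : A <= L.
Proof. by rewrite /L ler_pMr// lerDr. Qed.

Let L0 : 0 < L. Proof. exact: lt_le_trans chain_slope_ge. Qed.

Lemma transverse_ge0 x y : 0 <= transverse x y.
Proof. exact: sumr_ge0. Qed.

Lemma step_cost_ge0 x y : 0 <= step_cost x y.
Proof.
rewrite /step_cost; case: ifP => _; last by rewrite mulr_ge0 ?mdist_ge0 ?ltW.
by rewrite addr_ge0// mulr_ge0 ?mdist_ge0 ?transverse_ge0// ltW.
Qed.

Lemma step_cost_le x y : step_cost x y <= L * mdist x y.
Proof.
rewrite /step_cost; case: ifP => _ //.
have : transverse x y <= #|I|%:R * mdist x y.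
  apply: (@le_trans _ _ (\sum_(j : I) mdist x y)); last first.
    by rewrite sumr_const mulr_natl.
  rewrite [leRHS](bigID (fun j => j != i))/= /transverse.
  rewrite -[leLHS]addr0; apply: lerD; first by apply: ler_sum => j _; exact: g_lip.
  by apply: sumr_ge0 => j _; exact: mdist_ge0.
move=> /(ler_wpM2l (ltW A0)) tl; rewrite /L mulrDr mulrDl mulr1 -mulrA.
apply: lerD => //; apply: ler_wpM2r; first exact: mdist_ge0.
exact: le_trans A1.
Qed.

Lemma chain_cost_ge0 x s : 0 <= chain_cost x s.
Proof.
elim: s x => [|y s IH] x //=.
by rewrite addr_ge0 ?mulr_ge0 ?expR_ge0 ?invr_ge0 ?step_cost_ge0// ltW.
Qed.

Lemma chain_fun_le_cost x s : z x <= chain_cost x s.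
Proof.
apply: ge_inf; last by exists s.
by exists 0 => _ [t _ <-]; exact: chain_cost_ge0.
Qed.

Lemma chain_fun_ge x b : (forall s, b <= chain_cost x s) -> b <= z x.
Proof.
move=> bs; apply: lb_le_inf; first by exists (chain_cost x [::]); exists [::].
by move=> _ [s _ <-].
Qed.

Lemma chain_fun_ge0 x : 0 <= z x.
Proof. by apply: chain_fun_ge => s; exact: chain_cost_ge0. Qed.

Lemma chain_fun_le1 x : z x <= 1.
Proof. exact: (chain_fun_le_cost x [::]). Qed.

Lemma chain_fun_step x y :
  z x <= step_cost x y / r + expR ((g i y - g i x) / r) * z y.
Proof.
rewrite -lerBlDl -ler_pdivrMl ?expR_gt0//; apply: chain_fun_ge => s.
by rewrite ler_pdivrMl ?expR_gt0// lerBlDl; exact: (chain_fun_le_cost x (y :: s)).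
Qed.

(** Since [z <= 1], expanding the exponential in [chain_fun_step] costs only an
    error of second order in the distance. *)
Lemma chain_fun_diff x y : mdist x y <= r / 2 ->
  r * z x - r * z y <=
  step_cost x y + (g i y - g i x) * z y + 2 * (mdist x y / r) * mdist x y.
Proof.
move=> xyr; pose a := (g i y - g i x) / r.
have gxy : `|g i y - g i x| <= mdist x y by rewrite metric_sym; exact: g_lip.
have ra : r * a = g i y - g i x by rewrite /a mulrC divfK ?gt_eqF.
have a2 : a <= 2^-1.
  rewrite /a ler_pdivrMr// mulrC; apply: le_trans xyr.
  exact: le_trans (ler_norm _) gxy.
have := ler_wpM2l (ltW r0) (chain_fun_step x y); rewrite -/a mulrDr.
have -> : r * (step_cost x y / r) = step_cost x y by rewrite mulrC divfK ?gt_eqF.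
move=> zx.
have := ler_wpM2r (chain_fun_ge0 y) (expR_le_quadratic a2).
move=> /(ler_wpM2l (ltW r0)).
have -> : r * ((1 + a + 2 * (a * a)) * z y) =
    r * z y + (r * a) * z y + 2 * (r * (a * a) * z y) by ring.
rewrite ra => ez.
have : r * (a * a) * z y <= mdist x y / r * mdist x y.
  have -> : r * (a * a) = (g i y - g i x) ^+ 2 / r.
    by rewrite mulrA ra /a expr2 mulrA.
  have sq : (g i y - g i x) ^+ 2 / r <= mdist x y / r * mdist x y.
    rewrite [leRHS]mulrAC -expr2; apply: ler_wpM2r; first by rewrite invr_ge0 ltW.
    by rewrite -[leLHS]real_normK ?num_real// lerXn2r ?nnegrE ?mdist_ge0.
  apply: le_trans sq; rewrite ler_piMr ?chain_fun_le1//.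
  by rewrite mulr_ge0 ?sqr_ge0// invr_ge0 ltW.
by lra.
Qed.

Lemma chain_fun_bdlip : r <= 1 -> bdlip (L + 2) (fun x => r * z x).
Proof.
move=> r1; split=> [x|x y].
  rewrite ger0_norm ?mulr_ge0 ?chain_fun_ge0 ?ltW//.
  have := ler_wpM2l (ltW r0) (chain_fun_le1 x); have := L0; lra.
have z0y := chain_fun_ge0 y; have z1y := chain_fun_le1 y.
have d0 := mdist_ge0 x y; have := step_cost_le x y.
have Ld : 0 <= L * mdist x y by rewrite mulr_ge0// ltW.
have [xyr|xyr] := leP (mdist x y) (r / 2); last first.
  have := ler_wpM2l (ltW r0) (chain_fun_le1 x).
  have : 0 <= r * z y by rewrite mulr_ge0// ltW.
  by rewrite mulrDl; lra.
have := chain_fun_diff xyr.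
have : (g i y - g i x) * z y <= mdist x y.
  apply: le_trans (ler_norm _) _; rewrite normrM -[leRHS]mulr1 metric_sym.
  by apply: ler_pM => //; [exact: g_lip | rewrite ger0_norm].
have : mdist x y / r * mdist x y <= 2^-1 * mdist x y.
  by rewrite ler_wpM2r// ler_pdivrMr// mulrC.
by rewrite mulrDl; lra.
Qed.

(** [r z + z0 g_i] varies on [K], near a point where [z] is about [z0], almost
    only with the transverse coordinates: this is the first-order form of
    [z x <= z y exp ((g_i y - g_i x) / r)]. *)
Lemma chain_fun_local z0 e x y : K x -> K y -> mdist x y <= r / A ->
  mdist x y <= r / 2 -> mdist x y / r <= e -> `|z y - z0| <= e ->
  (r * z x + z0 * g i x) - (r * z y + z0 * g i y) <=
  A * transverse x y + (dl + 3 * e) * mdist x y.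
Proof.
move=> Kx Ky xyA xyr xye zy; have := chain_fun_diff xyr.
rewrite {1}/step_cost asboolT// => zd; have d0 := mdist_ge0 x y.
have : (g i y - g i x) * (z y - z0) <= mdist x y * e.
  apply: le_trans (ler_norm _) _; rewrite normrM metric_sym.
  by apply: ler_pM => //; exact: g_lip.
have : mdist x y / r * mdist x y <= e * mdist x y by rewrite ler_wpM2r.
by lra.
Qed.

Lemma step_cost_ge_dist x y : dl * mdist x y <= step_cost x y.
Proof.
have d0 := mdist_ge0 x y; rewrite /step_cost; case: ifP => _.
  by rewrite lerDr mulr_ge0 ?transverse_ge0// ltW.
apply: ler_wpM2r => //; have := chain_slope_ge; have := A1; have := dl1; lra.
Qed.

Lemma step_cost_ge_transverse x y j : j != i ->
  A * `|g j x - g j y| <= step_cost x y.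
Proof.
move=> ji; have d0 := mdist_ge0 x y; rewrite /step_cost; case: ifP => _.
  apply: (@le_trans _ _ (A * transverse x y)); last first.
    by rewrite lerDl mulr_ge0// ltW.
  apply: ler_wpM2l; first exact: ltW.
  by rewrite /transverse (bigD1 j)//= lerDl sumr_ge0.
by apply: ler_pM => //; [exact: ltW|exact: chain_slope_ge|exact: g_lip].
Qed.

(** While the [i]-th coordinate has dropped by less than [r] since [p], the
    exponential weights exceed [e^-1], so the total cost of the steps made so
    far is at most [r]. Steps with an endpoint outside of [K] have slope [L],
    so [K] is left only for distances at most [r / L]. Here [S] bounds the cost
    paid so far, and [q] is the last visited point of [K]. *)
Lemma chain_follow p s x q S : 0 <= S -> g i p - g i x < r ->
  S + expR 1 * r * (expR ((g i x - g i p) / r) * chain_cost x s) <= r ->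
  dl * mdist p x <= S -> (forall j, j != i -> A * `|g j p - g j x| <= S) ->
  K q -> L * mdist q x <= S ->
  exists y q', [/\ r <= g i p - g i y <= r + r / A, dl * mdist p y <= r,
    forall j, j != i -> A * `|g j p - g j y| <= r, K q' & L * mdist q' y <= r].
Proof.
have AL := chain_slope_ge.
elim: s x q S => [|y s IH] x q S S0 gpx budget px gx Kq qx.
  exfalso; move: budget; apply/negP; rewrite -ltNge /= mulr1.
  apply: (@lt_le_trans _ _ (expR 1 * r * expR ((g i x - g i p) / r))); last lra.
  rewrite mulrAC -expRD ltr_pMl// expR_gt1.
  by rewrite -ltrBlDl sub0r ltr_pdivlMr//; lra.
set c := step_cost x y.
have c0 : 0 <= c := step_cost_ge0 x y.
set w := expR ((g i x - g i p) / r).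
have ew : 1 <= expR 1 * w.
  rewrite /w -expRD -[leLHS]expR0 ler_expR -lerBlDl sub0r ler_pdivlMr//; lra.
have ww : expR ((g i y - g i p) / r) = w * expR ((g i y - g i x) / r).
  by rewrite /w -expRD -mulrDl; congr (expR (_ / r)); ring.
have rc : r * (c / r) = c by rewrite mulrC divfK ?gt_eqF.
have cs0 := chain_cost_ge0 y s.
have ebudget :
    S + c + expR 1 * r * (expR ((g i y - g i p) / r) * chain_cost y s) <= r.
  apply: le_trans budget; rewrite /= -/c ww.
  set E := expR ((g i y - g i x) / r).
  have -> : expR 1 * r * (w * (c / r + E * chain_cost y s)) =
    expR 1 * w * (r * (c / r)) + expR 1 * r * (w * E * chain_cost y s) by ring.
  by rewrite rc; have := ler_wpM2r c0 ew; lra.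
have Sr : S + c <= r.
  apply: le_trans ebudget; rewrite lerDl.
  by rewrite !mulr_ge0 ?expR_ge0// ltW.
have py : dl * mdist p y <= S + c.
  have := ler_wpM2l (ltW dl0) (metric_triangle p x y).
  by have := step_cost_ge_dist x y; rewrite -/c; lra.
have gy j : j != i -> A * `|g j p - g j y| <= S + c.
  move=> ji; have := gx j ji; have := step_cost_ge_transverse x y ji; rewrite -/c.
  have := ler_wpM2l (ltW A0) (ler_distD (g j x) (g j p) (g j y)); lra.
have Adxy : A * mdist x y <= r.
  have cr : c <= r by lra.
  have [[Kx Ky xy]|nshort] := pselect [/\ K x, K y & mdist x y <= r / A].
    by rewrite mulrC -ler_pdivlMr.
  apply: le_trans cr; rewrite /c /step_cost asboolF//.
  by apply: ler_wpM2r => //; exact: mdist_ge0.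
have [q' [Kq' q'y]] : exists q', K q' /\ L * mdist q' y <= S + c.
  have [Ky|nKy] := pselect (K y).
    by exists y; split => //; rewrite mdistxx mulr0 addr_ge0.
  exists q; split => //.
  have -> : c = L * mdist x y by rewrite /c /step_cost asboolF// => -[].
  by have := ler_wpM2l (ltW L0) (metric_triangle q x y); lra.
have [gpy|gpy] := ltP (g i p - g i y) r.
  by apply: (IH y q' (S + c)) => //; rewrite addr_ge0.
exists y, q'; split => //; last exact: le_trans q'y Sr.
- rewrite gpy/= -(subrKA (g i x)); apply: lerD; first exact: ltW.
  apply: le_trans (ler_norm _) _; apply: le_trans (g_lip i x y) _.
  by rewrite ler_pdivlMr// mulrC.
- exact: le_trans py Sr.
- by move=> j ji; apply: le_trans (gy j ji) Sr.
Qed.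

(** As [A] grows the accuracy [2 r / A] improves, while the distance bound
    [2 r / dl] stays the same. *)
Lemma chain_move p : K p -> z p < expR (-1) ->
  exists q, [/\ K q, `|g i p - g i q - r| <= 2 * (r / A),
    forall j, j != i -> `|g j p - g j q| <= 2 * (r / A) & mdist p q <= 2 * r / dl].
Proof.
move=> Kp zp; have AL := chain_slope_ge.
have [s sp] : exists s, chain_cost p s < expR (-1).
  apply: contrapT => /forallNP ns.
  suff : expR (-1) <= z p by rewrite leNgt zp.
  by apply: chain_fun_ge => s; rewrite leNgt; apply/negP/ns.
have e1 : expR 1 * expR (-1) = 1 :> R by rewrite -expRD subrr expR0.
have [//|||||||y [q [gpy py gy Kq qy]]] := @chain_follow p s p p 0.
- by rewrite subrr.
- rewrite subrr mul0r expR0 mul1r add0r mulrAC -[leRHS]mul1r.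
  apply: ler_wpM2r; first exact: ltW.
  by rewrite -[leRHS]e1 ler_pM2l ?expR_gt0// ltW.
- by rewrite mdistxx mulr0.
- by move=> j _; rewrite subrr normr0 mulr0.
- by [].
- by rewrite mdistxx mulr0.
have qyA : mdist q y <= r / A.
  rewrite ler_pdivlMr// mulrC; apply: le_trans qy.
  by apply: ler_wpM2r => //; exact: mdist_ge0.
have gq j : `|g j q - g j y| <= r / A by apply: le_trans (g_lip j q y) qyA.
exists q; split => //.
- have := gq i; rewrite !ler_norml => /andP[? ?]; apply/andP; lra.
- move=> j ji; have : `|g j p - g j y| <= r / A.
    by rewrite ler_pdivlMr// mulrC gy.
  have := ler_distD (g j y) (g j p) (g j q); rewrite (distrC (g j y)).
  by have := gq j; lra.
- have py' : mdist p y <= r / dl by rewrite ler_pdivlMr// mulrC.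
  have qy' : mdist q y <= r / dl.
    apply: le_trans qyA _; rewrite ler_pM2l// lef_pV2 ?posrE//.
    exact: le_trans A1.
  have := metric_triangle p y q; rewrite (metric_sym y q); lra.
Qed.

End chains.

(** * Finite nets in compact sets *)

Section nets.
Context {R : realType} {X : metricType R}.

Lemma open_mdist_lt (x : X) (e : R) : open [set y | mdist x y < e].
Proof.
rewrite openE => y /= xy; apply/metricType_numDomainType.nbhs_mdistP.
exists (e - mdist x y) => [|w /= yw]; first by rewrite /= subr_gt0.
by have := metric_triangle x y w; lra.
Qed.

Lemma compact_finite_cover (K : set X) : compact K -> cover_compact K.
Proof.
move=> cK I D f fo Kf.
have [[x0 Kx0]|K0] := pselect (K !=set0); last first.
  by exists fset0 => // x Kx; exfalso; apply: K0; exists x.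
(* Any point of [K] can serve as base point. *)
pose pX : ptopologicalType := HB.pack_for ptopologicalType (X : Type) (isPointed.Build X x0) X.
have : @compact pX K by exact: cK.
rewrite (@compact_cover pX) => /(_ I D f fo Kf).
exact.
Qed.

Lemma compact_net (K E : set X) (e : R) : compact K -> E `<=` K -> 0 < e ->
  exists2 s : seq X, (forall y, y \in s -> E y) &
    (forall x, E x -> exists2 y, y \in s & mdist x y < e).
Proof.
move=> /compact_finite_cover cK EK e0.
have [|x Kx|D _ KD] := cK X K (fun y => [set x | mdist y x < e / 2]).
- by move=> y _; exact: open_mdist_lt.
- by exists x => //=; rewrite mdistxx divr_gt0.
have [s sE sD] : exists2 s : seq X, (forall y, y \in s -> E y) &
    forall w, w \in enum_fset D -> forall x, E x -> mdist w x < e / 2 ->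
    exists2 y, y \in s & mdist x y < e.
  elim: (enum_fset D) => [|w l [s sE sl]]; first by exists [::].
  have [[y [Ey wy]]|ny] := pselect (exists y, E y /\ mdist w y < e / 2).
    exists (y :: s) => [v|v]; rewrite inE => /predU1P[->//|]; first exact: sE.
      move=> x Ex wx; exists y; first by rewrite inE eqxx.
      by have := metric_triangle x w y; rewrite (metric_sym x w); lra.
    move=> vl x Ex vx; have [y' y's xy'] := sl v vl x Ex vx.
    by exists y' => //; rewrite inE y's orbT.
  exists s => // v; rewrite inE => /predU1P[->|vl] x Ex vx; last exact: sl vx.
  by exfalso; apply: ny; exists x.
exists s => // x Ex; have [w Dw wx] := KD x (EK x Ex).
exact: sD wx.
Qed.

End nets.

(** * Most points can move in every direction *)

Section chain_derivative.
Context {d} {R : realType} {X : measurableMetricType d R}.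
Variable nu : {measure set X -> \bar R}.
Hypothesis borel : forall A : set X, open A -> measurable A.
Variables (K0 : set X) (I : finType) (g : I -> X -> R).
Variables (T : I -> (X -> R) -> X -> R) (C A : R).
Hypotheses (cK0 : compact K0) (mK0 : measurable K0) (K0fin : (nu K0 < +oo)%E).
Hypotheses (gM : forall j, bdlip 1 (g j)) (derT : forall i, der_op nu (T i) C).
Hypothesis Tg : forall i j, \forall x \ae nu, K0 x -> T i (g j) x = (i == j)%:R.
Hypotheses (C1 : 1 <= C) (A1 : 1 <= A).

(** Chains of cost below [expR (-1)] make [g i] drop by [r]; the factor [1 / 2]
    lets this follow from the non-strict bound [z <= threshold]. *)
Definition threshold : R := expR (-1) / 2.
(** Small enough for [T i] to see the charge for length as a quarter of the
    threshold, and independent of the accuracy [A]. *)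
Definition fine_slope : R := threshold / (4 * C).
Local Notation sg := threshold.
Local Notation dl := fine_slope.
Local Notation L := (@chain_slope R I A).
Local Notation z i K r := (chain_fun g i K r A dl).

Let C0 : 0 < C. Proof. exact: lt_le_trans C1. Qed.

Lemma threshold_gt0 : 0 < sg. Proof. by rewrite divr_gt0 ?expR_gt0. Qed.

Lemma threshold_lt : sg < expR (-1).
Proof. have := @expR_gt0 R (-1); rewrite /sg; lra. Qed.

Lemma fine_slope_gt0 : 0 < dl.
Proof. by rewrite divr_gt0 ?threshold_gt0// mulr_gt0. Qed.

Lemma fine_slope_le1 : dl <= 1.
Proof.
rewrite /dl ler_pdivrMr ?mulr_gt0// mul1r.
apply: (@le_trans _ _ 1); last by have := C1; lra.
rewrite /sg; have : expR (-1) <= 1 :> R by rewrite -[leRHS]expR0 ler_expR lerN10.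
by have := @expR_gt0 R (-1); lra.
Qed.

Section fixed_scale.
Variables (i : I) (K : set X) (r : R).
Hypotheses (mK : measurable K) (KK0 : K `<=` K0) (r0 : 0 < r) (r1 : r <= 1).

Let L0 : 0 <= L.
Proof. by rewrite /L mulr_ge0 ?addr_ge0// (le_trans _ A1). Qed.

Let rzM := chain_fun_bdlip i K gM r0 A1 fine_slope_gt0 fine_slope_le1 r1.

(** On a ball so small that [z] is nearly a constant [z0], [chain_fun_local] puts
    [r z + z0 g_i] under [cone_condition_le], and [T i (g i) = 1]. *)
Lemma chain_fun_deriv_le : \forall x \ae nu, K x ->
  T i (fun x => r * z i K r x) x <= - z i K r x + sg / 2.
Proof.
have L0' := L0; have r0' := r0.
have [e eE e0] : exists2 e, e = sg / (16 * C) & 0 < e.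
  by exists (sg / (16 * C)); rewrite ?divr_gt0 ?threshold_gt0 ?mulr_gt0.
(* On balls of radius [eta / 2], [chain_fun_local] applies and [z] varies by at
   most [e]. *)
pose eta := Num.min (Num.min 1 (r / A)) (Num.min (r / 2) (Num.min (r * e) (r * e / (L + 2)))).
have A0 : 0 < A := lt_le_trans ltr01 A1.
have eta0 : 0 < eta.
  by rewrite !lt_min ltr01 !divr_gt0 ?mulr_gt0//; lra.
have [eta1 etaA eta2 etae etaL] : [/\ eta <= 1, eta <= r / A, eta <= r / 2,
    eta <= r * e & eta <= r * e / (L + 2)].
  by split; rewrite /eta !ge_min lexx ?orbT.
have eta20 : 0 < eta / 2 by lra.
have [s _ sK] := compact_net cK0 (@subset_refl _ K0) eta20.
suff piece y : \forall x \ae nu, (K `&` [set x | mdist y x < eta / 2]) x ->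
    T i (fun x => r * z i K r x) x <= - z i K r x + sg / 2.
  have : \forall x \ae nu, forall y, y \in s ->
      (K `&` [set x | mdist y x < eta / 2]) x ->
      T i (fun x => r * z i K r x) x <= - z i K r x + sg / 2.
    elim: (s) => [|y l IH]; first by apply: aeW.
    have py := piece y; apply: filterS2 py IH => x py IH y'.
    by rewrite inE => /predU1P[->|]; [exact: py|exact: IH].
  apply: filterS => x all_s Kx; have [y ys xy] := sK x (KK0 Kx).
  by apply: (all_s y ys); split => //=; rewrite metric_sym.
set E := K `&` _.
have mE : measurable E by apply: measurableI => //; apply: borel; exact: open_mdist_lt.
have EK0 : E `<=` K0 by move=> x [/KK0].
have Efin : (nu E < +oo)%E.
  by apply: le_lt_trans K0fin; apply: le_measure; rewrite ?inE.
have Ed x x' : E x -> E x' -> mdist x x' <= eta.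
  move=> [_ /= yx] [_ /= yx']; have := metric_triangle x y x'.
  by rewrite (metric_sym x y); lra.
pose z0 := z i K r y.
have Ez x : E x -> `|z i K r x - z0| <= e.
  move=> [_ /= yx].
  have : `|r * z i K r x - r * z0| <= (L + 2) * mdist x y by exact: bdlip_normB rzM.
  rewrite -mulrBr normrM gtr0_norm// => zxy.
  have : r * `|z i K r x - z0| <= r * e.
    apply: le_trans zxy _; rewrite mulrC -ler_pdivlMr; last lra.
    by rewrite metric_sym; apply: le_trans etaL; apply/ltW/(lt_le_trans yx); lra.
  by rewrite ler_pM2l.
pose f x := r * z i K r x + z0 * g i x.
have fM : bdlip (L + 2 + `|z0| * 1) f by apply: bdlipD => //; exact: bdlipZ.
have M0 : 0 <= L + 2 + `|z0| * 1 by rewrite addr_ge0 ?mulr_ge0//; lra.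
have dl0 := fine_slope_gt0.
have Tf : \forall x \ae nu, E x -> `|T i f x| <= C * (dl + 3 * e).
  apply: (@cone_condition_le _ _ _ nu borel (T i) C (derT i) E mE Efin I
    (fun j => j != i) g _ 1 A _ f M0 ler01 (ltW A0) _ _ _ fM) => //.
  - lra.
  - move=> j ji; have := Tg i j; apply: filterS => x + Ex.
    by move=> /(_ (EK0 x Ex)) ->; rewrite eq_sym (negbTE ji).
  - exact: ltW.
  - by move=> x x' Ex Ex'; apply: le_trans (Ed x x' Ex Ex') eta1.
  - move=> x x' Ex Ex'; have xx' := Ed x x' Ex Ex'.
    apply: (chain_fun_local gM r0 A1 dl0) => //.
    + by case: Ex.
    + by case: Ex'.
    + exact: le_trans etaA.
    + exact: le_trans eta2.
    + by rewrite ler_pdivrMr// mulrC; apply: le_trans etae.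
    + exact: Ez.
  - move=> e' e'0; apply: (compact_net cK0 EK0 e'0).
have fD : \forall x \ae nu, T i f x = T i (fun x => r * z i K r x) x + T i (fun x => z0 * g i x) x.
  apply: (der_opD (derT i) (M := L + 2 + `|z0| * 1)).
    by apply: bdlip_le rzM; rewrite lerDl mulr_ge0.
  by apply: bdlip_le (bdlipZ z0 (gM i)); rewrite lerDr; lra.
have fZ := der_opZ (derT i) z0 (gM i).
have Tgi := Tg i i.
have TfD : \forall x \ae nu, K0 x -> T i f x = T i (fun x => r * z i K r x) x + z0.
  by apply: filterS3 fD fZ Tgi => x -> -> Tgi K0x; rewrite (Tgi K0x) eqxx mulr1.
apply: filterS2 Tf TfD => x Tfx TfDx Ex.
have := Tfx Ex; rewrite (TfDx (EK0 x Ex)) ler_norml => /andP[_].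
have := Ez x Ex; rewrite ler_norml => /andP[_].
have -> : C * (dl + 3 * e) = sg / 4 + 3 * (sg / 16).
  by rewrite /dl eE; field; rewrite gt_eqF.
have : e <= sg / 16.
  rewrite eE invfM mulrA ler_piMr ?divr_ge0 ?(ltW threshold_gt0)//.
  by rewrite invf_le1.
by have := threshold_gt0; lra.
Qed.

(** A bound on the integral of [T i (r z)] would only control [z] on average.
    Above the threshold the negative term [- z] dominates the error, so cutting
    there controls the measure of the points where [z] is large. *)
Definition excess x : R := Num.max (r * z i K r x + - (r * sg)) 0.

Definition stuck : set X := K `&` [set x | sg < z i K r x].

Let sg1 : sg <= 1.
Proof.
apply: le_trans (ltW threshold_lt) _.
by rewrite -[leRHS]expR0 ler_expR lerN10.
Qed.

Let rsg_bdlip : bdlip 1 (fun _ : X => - (r * sg)).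
Proof.
have rsg0 : 0 <= r * sg by apply: mulr_ge0; apply: ltW => //; exact: threshold_gt0.
apply: bdlip_le (bdlip_cst _); rewrite normrN ger0_norm//.
by rewrite -[leRHS]mul1r; apply: ler_pM => //; apply: ltW => //; exact: threshold_gt0.
Qed.

Let shifted_bdlip : bdlip (L + 3) (fun x => r * z i K r x + - (r * sg)).
Proof.
have -> : L + 3 = L + 2 + 1 by ring.
exact: bdlipD.
Qed.

Lemma excess_bdlip : bdlip (L + 3) excess.
Proof.
apply: bdlip_max => //; apply: bdlip_le (bdlip_cst 0).
by rewrite normr0; have := L0; lra.
Qed.

Lemma excess_norm_le x : `|excess x| <= r.
Proof.
rewrite ger0_norm /excess ?le_max ?lexx ?orbT// ge_max (ltW r0) andbT.
have := ler_wpM2l (ltW r0) (chain_fun_le1 g i K r0 A1 fine_slope_gt0 x).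
have : 0 <= r * sg by apply: mulr_ge0; apply: ltW => //; exact: threshold_gt0.
by lra.
Qed.

Lemma measurable_stuck : measurable stuck.
Proof.
apply: measurableI => //.
have -> : [set x | sg < z i K r x] = [set x | - (r * z i K r x) < - (r * sg)].
  by apply/seteqP; split=> x /=; rewrite ltrN2 ltr_pM2l.
exact: bdlip_measurable_lt (bdlipN rzM).
Qed.

Lemma subset_finite (B : set X) : measurable B -> B `<=` K0 -> (nu B < +oo)%E.
Proof.
by move=> mB BK; apply: le_lt_trans K0fin; apply: le_measure; rewrite ?inE.
Qed.

Lemma excess_deriv_stuck : \forall x \ae nu, stuck x -> T i excess x <= - (sg / 2).
Proof.
have stuckK0 : stuck `<=` K0 by move=> x [/KK0].
have loc : \forall x \ae nu, stuck x ->
    T i excess x = T i (fun x => r * z i K r x + - (r * sg)) x.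
  apply: (der_op_local (derT i) measurable_stuck _ excess_bdlip shifted_bdlip).
    exact: subset_finite measurable_stuck stuckK0.
  move=> x [_ /= sz]; rewrite /excess max_l// subr_ge0.
  by rewrite ler_pM2l// ltW.
have D := der_opD (derT i) (M := L + 3) (bdlip_le _ rzM) (bdlip_le _ rsg_bdlip).
have {}D : \forall x \ae nu, T i (fun x => r * z i K r x + - (r * sg)) x =
    T i (fun x => r * z i K r x) x + T i (fun=> - (r * sg)) x.
  by apply: D; have := L0; lra.
have c0 := der_op_cst (derT i) (- (r * sg)).
have {}D : \forall x \ae nu, T i (fun x => r * z i K r x + - (r * sg)) x =
    T i (fun x => r * z i K r x) x.
  by apply: filterS2 D c0 => x -> ->; rewrite addr0.
apply: filterS3 loc D chain_fun_deriv_le => x loc Dx zx st.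
by rewrite (loc st) Dx; have := zx (proj1 st); case: st => _ /=; lra.
Qed.

Lemma excess_deriv_free : \forall x \ae nu, (K `\` stuck) x -> T i excess x = 0.
Proof.
have mf : measurable (K `\` stuck) by apply: measurableD => //; exact: measurable_stuck.
apply: (der_op_local0 (derT i) mf _ excess_bdlip).
  by apply: subset_finite => // x [/KK0].
move=> x [Kx nst]; rewrite /excess max_r// subr_le0 ler_pM2l// leNgt.
by apply/negP => sz; apply: nst.
Qed.

Lemma Rintegral_indic_sub (B : set X) : measurable B -> B `<=` K0 ->
  \int[nu]_(x in K0) \1_B x = fine (nu B).
Proof. by move=> mB BK; rewrite /Rintegral integral_indic// setIidl. Qed.

Lemma integrable_indic_sub (B : set X) : measurable B ->
  nu.-integrable K0 (EFin \o (\1_B : X -> R)).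
Proof.
move=> mB; apply: measurable_bounded_integrable => //.
exists 1; split => // N N1 x _ /=; rewrite ger0_norm ?indicE//.
by case: (x \in B) => /=; rewrite ?mulr1n ?mulr0n; lra.
Qed.

Lemma excess_integral_le : \int[nu]_(x in K0) T i excess x <=
  C * (L + 3) * fine (nu (K0 `\` K)) - sg / 2 * fine (nu stuck).
Proof.
have mD : measurable (K0 `\` K) by exact: measurableD.
have mst := measurable_stuck; have CL0 : 0 <= C * (L + 3).
  by rewrite mulr_ge0 ?(ltW C0)//; have := L0; lra.
have int1 : nu.-integrable K0 (EFin \o (fun x => C * (L + 3) * \1_(K0 `\` K) x)).
  have := integrableZl mK0 (C * (L + 3)) (integrable_indic_sub mD).
  by apply: eq_integrable.
have int2 : nu.-integrable K0 (EFin \o (fun x => sg / 2 * \1_stuck x)).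
  have := integrableZl mK0 (sg / 2) (integrable_indic_sub mst).
  by apply: eq_integrable.
have -> : C * (L + 3) * fine (nu (K0 `\` K)) - sg / 2 * fine (nu stuck) =
    \int[nu]_(x in K0) (C * (L + 3) * \1_(K0 `\` K) x - sg / 2 * \1_stuck x).
  rewrite RintegralB// !RintegralZl//; try exact: integrable_indic_sub.
  have stK0 : stuck `<=` K0 by move=> x [/KK0].
  have DK0 : K0 `\` K `<=` K0 by move=> x [].
  by rewrite !Rintegral_indic_sub.
apply: le_Rintegral_ae => //.
- exact: (der_op_integrable (derT i) mK0 K0fin excess_bdlip).
- by have := integrableB mK0 int1 int2.
- apply: filterS2 excess_deriv_stuck excess_deriv_free => x st fr K0x.
  rewrite !indicE.
  have [Kx|nKx] := pselect (K x); last first.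
    have nst : ~ stuck x by case.
    rewrite (mem_set (conj K0x nKx : (K0 `\` K) x)) (memNset nst) mulr1 mulr0 subr0.
    by apply: le_trans (ler_norm _) _; apply: (der_op_bounded (derT i) _ excess_bdlip).
  have nD : ~ (K0 `\` K) x by case.
  rewrite (memNset nD) mulr0 sub0r.
  have [stx|nst] := pselect (stuck x); first by rewrite mem_set// mulr1; exact: st.
  by rewrite memNset// fr ?mulr0 ?oppr0.
Qed.

End fixed_scale.

Definition vanishing (B : nat -> set X) : Prop :=
  (forall n, measurable (B n) /\ B n `<=` K0) /\
  fine (nu (B n)) @[n --> \oo] --> (0 : R).

Lemma vanishingU B B' : vanishing B -> vanishing B' ->
  vanishing (fun n => B n `|` B' n).
Proof.
move=> [Bm B0] [B'm B'0].
have BB'm n : measurable (B n `|` B' n) /\ B n `|` B' n `<=` K0.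
  have [mB BK] := Bm n; have [mB' B'K] := B'm n.
  by split; [exact: measurableU|rewrite subUset].
split => //; have lim0 : fine (nu (B n)) + fine (nu (B' n)) @[n --> \oo] --> (0 : R).
  by rewrite -[0]addr0; exact: cvgD.
apply: (squeeze_cvgr _ (cvg_cst 0) lim0); apply: nearW => n.
have [mB BK] := Bm n; have [mB' B'K] := B'm n; have [mU UK] := BB'm n.
have fin E : measurable E -> E `<=` K0 -> nu E \is a fin_num.
  by move=> mE EK; rewrite ge0_fin_numE//; exact: subset_finite.
rewrite fine_ge0//= -fineD ?fin//; apply: fine_le; first exact: fin.
  by rewrite fin_numD !fin.
by apply: measureU2.
Qed.

Definition scale n : R := n.+1%:R^-1.

Lemma scale_gt0 n : 0 < scale n. Proof. by rewrite invr_gt0. Qed.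

Lemma scale_le1 n : scale n <= 1. Proof. by rewrite invf_le1// ler1n. Qed.

(** The functions [excess], of size [scale n], tend weak* to [0], while their
    derivatives are nonpositive up to the measure of [K0 `\` K n]. *)
Lemma vanishing_stuck i (K : nat -> set X) :
  (forall n, measurable (K n)) -> vanishing (fun n => K0 `\` K n) ->
  (forall n, K n `<=` K0) ->
  vanishing (fun n => stuck i (K n) (scale n)).
Proof.
move=> mK [_ K0K] KK0.
have mS n : measurable (stuck i (K n) (scale n)).
  by apply: measurable_stuck; rewrite ?scale_gt0 ?scale_le1.
have SK n : stuck i (K n) (scale n) `<=` K0 by move=> x [/KK0].
split => //.
pose u n := excess i (K n) (scale n).
have uM n : bdlip (L + 3) (u n) by apply: excess_bdlip; rewrite ?scale_gt0 ?scale_le1.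
have b0 : bdlip (L + 3) (fun _ : X => 0 : R).
  apply: bdlip_le (bdlip_cst 0); rewrite normr0 addr_ge0// mulr_ge0 ?addr_ge0//.
  exact: le_trans A1.
have u0 x : u n x @[n --> \oo] --> (0 : R).
  apply: (@cvg_le_harmonic _ _ _ 1) => n; rewrite mul1r subr0.
  by apply: excess_norm_le; rewrite ?scale_gt0 ?scale_le1.
have := der_op_cvg_in (derT i) mK0 K0fin uM b0 u0.
have -> : \int[nu]_(x in K0) T i (fun=> 0) x = 0.
  have T0 := der_op_cst (derT i) 0.
  have i0 : nu.-integrable K0 (EFin \o (fun _ : X => 0 : R)).
    apply: measurable_bounded_integrable => //; exact: bounded_cst.
  have iT0 := der_op_integrable (derT i) mK0 K0fin b0.
  have I0 : \int[nu]_(x in K0) (0 : R) = 0 by rewrite Rintegral_cst// mul0r.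
  rewrite -[RHS]I0; apply/eqP; rewrite eq_le; apply/andP; split.
  - by apply: le_Rintegral_ae => //; apply: filterS T0 => x ->.
  - by apply: le_Rintegral_ae => //; apply: filterS T0 => x ->.
move=> Tu0.
have lim0 : (sg / 2)^-1 * (C * (L + 3) * fine (nu (K0 `\` K n)) -
    \int[nu]_(x in K0) T i (u n) x) @[n --> \oo] --> (0 : R).
  have -> : 0 = (sg / 2)^-1 * (C * (L + 3) * 0 - 0) by rewrite mulr0 subrr mulr0.
  by apply: cvgMr; apply: cvgB => //; apply: cvgMr.
apply: (squeeze_cvgr _ (cvg_cst 0) lim0); apply: nearW => n.
rewrite fine_ge0//= ler_pdivlMl ?divr_gt0 ?threshold_gt0//.
have := excess_integral_le i (mK n) (KK0 n) (scale_gt0 n) (scale_le1 n).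
rewrite -/(u n); lra.
Qed.

(** Relative to [K] itself: a move must end where the next one can start. *)
Definition good n (K : set X) : set X :=
  K `&` [set x | forall i, z i K (scale n) x <= sg].

Let bigsetUP (F : I -> set X) x :
  (\big[setU/set0]_(i : I) F i) x <-> exists i, F i x.
Proof.
rewrite -bigcup_seq; split=> [[i _ Fi]|[i Fi]]; first by exists i.
by exists i => //=; rewrite mem_index_enum.
Qed.

Lemma good_stuckE n K : good n K =
  K `\` \big[setU/set0]_(i : I) stuck i K (scale n).
Proof.
apply/seteqP; split=> x [Kx zx]; split => //.
  by move=> /bigsetUP[i [_ /=]]; rewrite ltNge zx.
move=> i; rewrite leNgt; apply/negP => zi; apply: zx; apply/bigsetUP.
by exists i.
Qed.

Lemma good_sub n K : good n K `<=` K. Proof. exact: subIsetl. Qed.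

Lemma measurable_good n K : measurable K -> K `<=` K0 -> measurable (good n K).
Proof.
move=> mK KK0; rewrite good_stuckE.
apply: measurableD => //; apply: bigsetU_measurable => i _.
by apply: measurable_stuck; rewrite ?scale_gt0 ?scale_le1.
Qed.

Lemma vanishing_good (K : nat -> set X) : (forall n, measurable (K n)) ->
  (forall n, K n `<=` K0) -> vanishing (fun n => K0 `\` K n) ->
  vanishing (fun n => K0 `\` good n (K n)).
Proof.
move=> mK KK0 vK.
have v0 : vanishing (fun=> set0).
  by split => [n|]; [split|rewrite measure0; exact: cvg_cst].
have vS : vanishing (fun n => \big[setU/set0]_(i : I) stuck i (K n) (scale n)).
  elim: (index_enum I) => [|i l IH].
    by under eq_fun do rewrite big_nil.
  under eq_fun do rewrite big_cons.
  by apply: vanishingU => //; exact: vanishing_stuck.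
have := vanishingU vK vS; congr vanishing; apply/funext => n.
rewrite good_stuckE; apply/seteqP; split=> x.
  case=> [[K0x nKx]|/bigsetUP[i [Kx zi]]].
    by split => // -[].
  split; first exact: KK0 Kx.
  by move=> [_]; apply; apply/bigsetUP; exists i.
case=> K0x nKS; have [Kx|nKx] := pselect (K n x); last by left.
by right; apply: contrapT => nS; apply: nKS.
Qed.

Lemma iter_good n k : measurable (iter k (good n) K0) /\ iter k (good n) K0 `<=` K0.
Proof.
elim: k => [|k [mk kK]] /=; first by split.
by split; [exact: measurable_good | move=> x /good_sub/kK].
Qed.

Lemma vanishing_iter_good k : vanishing (fun n => K0 `\` iter k (good n) K0).
Proof.
elim: k => [|k IH] /=.
  under eq_fun do rewrite setDv.
  by split => [n|]; [split|rewrite measure0; exact: cvg_cst].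
by apply: vanishing_good => // n; case: (iter_good n k).
Qed.

Lemma iter_good_nonempty k : (0 < nu K0)%E ->
  exists n, iter k (good n) K0 !=set0.
Proof.
move=> nuK0; apply: contrapT => /forallNP nne.
have [_] := vanishing_iter_good k.
have -> : (fun n => fine (nu (K0 `\` iter k (good n) K0))) = (fun=> fine (nu K0)).
  apply/funext => n; have /set0P/negP/negPn/eqP -> := nne n.
  by rewrite setD0.
move=> /(cvg_unique _ (cvg_cst (fine (nu K0)))) /= nu0.
suff : fine (nu K0) > 0 by rewrite nu0 ?ltxx//; exact: norm_hausdorff.
by apply: fine_gt0; rewrite nuK0.
Qed.

Lemma good_move n K p i : good n K p -> exists q,
  [/\ K q, `|g i p - g i q - scale n| <= 2 * (scale n / A),
    forall j, j != i -> `|g j p - g j q| <= 2 * (scale n / A) &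
    mdist p q <= 2 * scale n / dl].
Proof.
move=> [Kp zp].
apply: (chain_move gM (scale_gt0 n) A1 fine_slope_gt0 fine_slope_le1 Kp).
exact: le_lt_trans (zp i) threshold_lt.
Qed.

(** Each level of [good] allows one more move: a displacement with positive [i]-th
    component starts with a move along [i] into the previous level. *)
Lemma grid_move n k (a : I -> nat) p : (\sum_i a i)%N = k ->
  iter k (good n) K0 p -> exists q,
  [/\ K0 q, forall j, `|g j p - g j q - (a j)%:R * scale n| <=
      k%:R * (2 * (scale n / A)) & mdist p q <= k%:R * (2 * scale n / dl)].
Proof.
elim: k a p => [|k IH] a p ak.
  move=> K0p; exists p; split => //; last by rewrite mdistxx mul0r.
  move=> j; have -> : a j = 0%N.
    by apply/eqP; move/eqP: ak; rewrite sum_nat_eq0 => /forallP /(_ j).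
  by rewrite mul0r subrr subr0 normr0 mul0r.
move=> /= gp.
have [i ai] : exists i, (0 < a i)%N.
  apply: contrapT => /forallNP a0; suff : (\sum_i a i)%N = 0%N by rewrite ak.
  by apply: big1 => i _; have := a0 i; case: (a i).
have [q1 [q1K gi gj d1]] := good_move i gp.
pose b j := if j == i then (a i).-1 else a j.
have bk : (\sum_j b j)%N = k.
  apply: succn_inj; rewrite -ak (bigD1 i)//= [RHS](bigD1 i)//= {1}/b eqxx.
  rewrite -addSn prednK//; congr addn; apply: eq_bigr => j ji.
  by rewrite /b (negbTE ji).
have [q [K0q gq dq]] := IH b q1 bk q1K.
have kE : k.+1%:R = k%:R + 1 :> R by rewrite natr1.
exists q; split => //; last first.
  have := metric_triangle p q1 q; rewrite kE mulrDl mul1r; lra.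
move=> j; rewrite kE [leRHS]mulrDl mul1r; have := gq j; rewrite /b.
have [->|ji] := eqVneq j i => gqj.
  have aiE : (a i)%:R = (a i).-1%:R + 1 :> R by rewrite natr1 prednK.
  rewrite aiE (_ : _ - _ = g i q1 - g i q - (a i).-1%:R * scale n +
    (g i p - g i q1 - scale n)); last by ring.
  by apply: le_trans (ler_normD _ _) _; apply: lerD.
rewrite (_ : _ - _ = g j q1 - g j q - (a j)%:R * scale n + (g j p - g j q1));
  last by ring.
by apply: le_trans (ler_normD _ _) _; apply: lerD => //; exact: gj.
Qed.

End chain_derivative.

(** * Counting separated points *)

Section counting.
Context {R : realType}.

Lemma diam_le (X : metricType R) (B : set X) (b : R) :
  (forall x y, B x -> B y -> mdist x y <= b) -> (diam B <= b%:E)%E.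
Proof.
by move=> Bb; apply: ge_ereal_sup => _ [x Bx [y By <-]]; rewrite lee_fin Bb.
Qed.

Lemma mdist_le_diam (X : metricType R) (B : set X) (b : R) x y :
  (diam B <= b%:E)%E -> B x -> B y -> mdist x y <= b.
Proof.
move=> Bb Bx By; rewrite -lee_fin; apply: le_trans Bb.
by apply: ereal_sup_ubound; exists x => //; exists y.
Qed.

Lemma separated_card_le (X : metricType R) (s : R) : assouad_exponent X s ->
  exists C : R, forall (F : finType) (q : F -> X) (p : X) (eps r : R),
    0 < eps < 1 -> 0 < r -> (forall a, mdist p (q a) <= r / 2) ->
    (forall a b, a != b -> eps * r < mdist (q a) (q b)) ->
    #|F|%:R <= C * eps `^ (- s).
Proof.
move=> [C cover]; exists C => F q p eps r eps01 r0 pq sep.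
have [|n [B [nC Bdiam Bcover]]] := cover eps r eps01 r0 (range q).
  apply: diam_le => _ _ [a _ <-] [b _ <-].
  have := metric_triangle (q a) p (q b); rewrite (metric_sym (q a) p).
  by have := pq a; have := pq b; lra.
apply: le_trans nC; rewrite ler_nat.
have /choice[h hB] a : exists i : 'I_n, B i (q a).
  by have [|i _ Bi] := Bcover (q a); [exists a|exists i].
rewrite -[leqRHS]card_ord; apply: (leq_card h) => a b hab.
apply/eqP/negPn/negP => /sep; rewrite ltNge => /negP; apply.
by apply: mdist_le_diam (Bdiam (h a)) _ _ => //; rewrite hab.
Qed.

(** Otherwise [m `^ (N - s)] would be bounded in [m]. *)
Lemma exponent_le (N : nat) (s C c : R) : 0 < c ->
  (forall m : nat, (0 < m)%N -> (m ^ N)%:R <= C * (c * m%:R) `^ s) -> N%:R <= s.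
Proof.
move=> c0 NC; rewrite leNgt; apply/negP => sN.
pose t := N%:R - s; have t0 : 0 < t by rewrite subr_gt0.
pose B := C * c `^ s.
have mB (m : nat) : (0 < m)%N -> m%:R `^ t <= B.
  move=> m0; have m0' : 0 < m%:R :> R by rewrite ltr0n.
  have cm : (c * m%:R) `^ s = c `^ s * m%:R `^ s by rewrite powRM// ltW.
  have := NC m m0; rewrite cm mulrA -/B natrX -powR_mulrn// => H.
  rewrite /t powRD ?powRN ?ler_pdivrMr ?powR_gt0//.
  by apply/implyP => _; rewrite gt_eqF.
pose b := (`|B| + 1) `^ t^-1.
have b0 : 0 <= b by exact: powR_ge0.
pose m := (Num.trunc b).+1.
have bm : b <= m%:R by apply/ltW; rewrite /m; have /andP[] := truncn_itv b0.
have := mB m isT; apply/negP; rewrite -ltNge.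
apply: (@lt_le_trans _ _ (`|B| + 1)); first by have := ler_norm B; lra.
have -> : `|B| + 1 = b `^ t.
  by rewrite /b -powRrM mulVf ?gt_eqF// powRr1// addr_ge0.
by rewrite ge0_ler_powR ?nnegrE// ?ltW.
Qed.

Lemma grid_gap (x y y' r : R) (a b : nat) : 0 < r -> (a < b)%N ->
  `|x - y - a%:R * r| <= r / 8 -> `|x - y' - b%:R * r| <= r / 8 ->
  r / 2 < `|y - y'|.
Proof.
move=> r0 ab; rewrite !ler_norml => /andP[_ ya] /andP[yb _].
have : a%:R + 1 <= b%:R :> R by rewrite natr1 ler_nat.
move=> /(ler_wpM2r (ltW r0)) ar; apply: lt_le_trans (ler_norm _); lra.
Qed.

(** Displacing one point in the directions of all [#|I|] coordinates gives, for
    every [m], [m ^ #|I|] points which are [r / 2]-separated within a distance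
    [O(m r)]: an Assouad exponent cannot be smaller than [#|I|]. *)
Lemma card_le_assouad_exponent d (X : measurableMetricType d R)
    (nu : {measure set X -> \bar R}) (K0 : set X) (I : finType)
    (g : I -> X -> R) (T : I -> (X -> R) -> X -> R) (C s : R) :
  (forall A : set X, open A -> measurable A) ->
  compact K0 -> measurable K0 -> (0 < nu K0 < +oo)%E ->
  (forall j, bdlip 1 (g j)) -> (forall i, der_op nu (T i) C) ->
  (forall i j, \forall x \ae nu, K0 x -> T i (g j) x = (i == j)%:R) -> 1 <= C ->
  assouad_exponent X s -> #|I|%:R <= s.
Proof.
move=> borel cK0 mK0 /andP[K0gt0 K0fin] gM derT Tg C1 /separated_card_le[Cs card_le].
set N := #|I|; set dl := fine_slope C.
have dl0 : 0 < dl by exact: fine_slope_gt0.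
have dl1 : dl <= 1 by exact: fine_slope_le1.
have N1 : 0 < N%:R + 1 :> R by rewrite ltr_wpDl.
pose c := 8 * (N%:R + 1) / dl; have c0 : 0 < c by rewrite divr_gt0// mulr_gt0.
apply: (@exponent_le N s Cs c c0) => m m0.
have m1 : 1 <= m%:R :> R by rewrite ler1n.
have m0' : 0 < m%:R :> R by rewrite ltr0n.
(* After [N * m] moves of accuracy [2 r / A], the accumulated error is at most
   [r / 8]: distinct grid points have images at distance at least [3 r / 4]. *)
pose A := 16 * ((N%:R + 1) * m%:R) : R.
have Nm1 : 1 <= (N%:R + 1) * m%:R :> R.
  by rewrite -[leLHS]mulr1; apply: ler_pM => //; rewrite lerDr.
have A1 : 1 <= A by rewrite /A; lra.
have A0 : 0 < A by lra.
pose k := (N * m)%N.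
have kE : k%:R <= (N%:R + 1) * m%:R :> R.
  by rewrite natrM; apply: ler_wpM2r => //; rewrite lerDl.
have [n [p Kp]] := iter_good_nonempty borel cK0 mK0 K0fin gM derT Tg C1 A1 k K0gt0.
have sub_iter k1 k2 : (k1 <= k2)%N ->
    iter k2 (good g C A n) K0 `<=` iter k1 (good g C A n) K0.
  move=> k12; rewrite -(subnK k12) iterD; elim: (k2 - k1)%N => [|l IH] //=.
  by apply: subset_trans IH; exact: good_sub.
set r : R := scale n; have r0 : 0 < r by exact: scale_gt0.
have /choice[q qP] (a : {ffun I -> 'I_m}) : exists q : X,
    (forall j, `|g j p - g j q - (a j)%:R * r| <= r / 8) /\
    mdist p q <= (N%:R + 1) * m%:R * (2 * r / dl).
  pose b j : nat := a j.
  have bk : (\sum_j b j <= k)%N.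
    rewrite /k /N -sum_nat_const; apply: leq_sum => j _; exact: (ltnW (ltn_ord (a j))).
  have [q [_ gq pq]] := grid_move gM C1 A1 (erefl (\sum_j b j)%N) (sub_iter _ _ bk p Kp).
  have bR : (\sum_j b j)%:R <= (N%:R + 1) * m%:R :> R.
    by apply: le_trans kE; rewrite ler_nat.
  exists q; split=> [j|].
    apply: le_trans (gq j) _; rewrite -/r.
    apply: (@le_trans _ _ ((N%:R + 1) * m%:R * (2 * (r / A)))).
      by apply: ler_wpM2r => //; apply: mulr_ge0 => //; apply: divr_ge0; exact: ltW.
    rewrite le_eqVlt; apply/orP; left; apply/eqP; rewrite /A; field.
    by rewrite !gt_eqF.
  apply: le_trans pq _; apply: ler_wpM2r => //.
  by apply: divr_ge0; [apply: mulr_ge0 => // | ]; exact: ltW.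
pose R0 := 4 * ((N%:R + 1) * m%:R * (r / dl)).
have R00 : 0 < R0 by rewrite !mulr_gt0 ?invr_gt0.
pose eps := (c * m%:R)^-1.
have cm1 : 1 < c * m%:R.
  rewrite /c mulrAC ltr_pdivlMr// mul1r; apply: (le_lt_trans dl1).
  by rewrite -mulrA; lra.
have eps01 : 0 < eps < 1 by rewrite invr_gt0 invf_lt1 ?cm1 ?(lt_trans _ cm1)//.
have epsR : eps * R0 = r / 2.
  by rewrite /eps /R0 /c; field; rewrite !gt_eqF.
have := @card_le {ffun I -> 'I_m} q p eps R0 eps01 R00.
rewrite card_ffun card_ord -/N.
have -> : eps `^ (- s) = (c * m%:R) `^ s.
  have cm0 : 0 <= c * m%:R by apply: ltW; apply: lt_trans cm1.
  by rewrite /eps -powR_inv1// -powRrM mulN1r opprK.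
apply.
- move=> a; apply: le_trans (proj2 (qP a)) _.
  by rewrite /R0 le_eqVlt; apply/orP; left; apply/eqP; field; rewrite gt_eqF.
- move=> a b ab; rewrite epsR.
  have [j abj] : exists j, a j != b j.
    apply: contrapT => /forallNP nab; move/eqP: ab; apply; apply/ffunP => j.
    by apply/eqP/negPn/negP; exact: nab.
  have [ga _] := qP a; have [gb _] := qP b.
  have [ltab|ltba|/val_inj eab] := ltngtP (a j) (b j); last by rewrite eab eqxx in abj.
    apply: lt_le_trans (g_lip gM j (q a) (q b)).
    exact: grid_gap r0 ltab (ga j) (gb j).
  rewrite metric_sym; apply: lt_le_trans (g_lip gM j (q b) (q a)).
  exact: grid_gap r0 ltba (gb j) (ga j).
Qed.

End counting.

(** * Combinations with bounded measurable coefficients *)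

Section bounded_measurable_functions.
Context {d} {R : realType} {X : measurableType d}.
Implicit Types h : X -> R.

Definition bounded_measurable h : Prop :=
  measurable_fun setT h /\ exists b, forall x, `|h x| <= b.

Lemma bounded_measurable_cst c : bounded_measurable (fun=> c).
Proof. by split => //; exists `|c|. Qed.

Lemma bounded_measurableD h1 h2 : bounded_measurable h1 -> bounded_measurable h2 ->
  bounded_measurable (fun x => h1 x + h2 x).
Proof.
move=> [m1 [b1 hb1]] [m2 [b2 hb2]]; split; first exact: measurable_funD.
exists (b1 + b2) => x; apply: le_trans (ler_normD _ _) _; exact: lerD.
Qed.

Lemma bounded_measurableM h1 h2 : bounded_measurable h1 -> bounded_measurable h2 ->
  bounded_measurable (fun x => h1 x * h2 x).
Proof.
move=> [m1 [b1 hb1]] [m2 [b2 hb2]]; split; first exact: measurable_funM.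
by exists (b1 * b2) => x; rewrite normrM ler_pM.
Qed.

Lemma bounded_measurable_sum (I : Type) (s : seq I) (h : I -> X -> R) :
  (forall i, bounded_measurable (h i)) ->
  bounded_measurable (fun x => \sum_(i <- s) h i x).
Proof.
move=> hb; elim: s => [|i s IH].
  by under eq_fun do rewrite big_nil; exact: bounded_measurable_cst.
by under eq_fun do rewrite big_cons; exact: bounded_measurableD.
Qed.

Lemma bounded_measurable_prod (I : Type) (s : seq I) (h : I -> X -> R) :
  (forall i, bounded_measurable (h i)) ->
  bounded_measurable (fun x => \prod_(i <- s) h i x).
Proof.
move=> hb; elim: s => [|i s IH].
  by under eq_fun do rewrite big_nil; exact: bounded_measurable_cst.
by under eq_fun do rewrite big_cons; exact: bounded_measurableM.
Qed.

Lemma bounded_measurable_det k (A : X -> 'M[R]_k) :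
  (forall i j, bounded_measurable (fun x => A x i j)) ->
  bounded_measurable (fun x => \det (A x)).
Proof.
move=> Ab; apply: bounded_measurable_sum => s.
apply: bounded_measurableM; first exact: bounded_measurable_cst.
by apply: bounded_measurable_prod.
Qed.

Lemma bounded_measurable_cofactor k (A : X -> 'M[R]_k) i j :
  (forall i j, bounded_measurable (fun x => A x i j)) ->
  bounded_measurable (fun x => cofactor (A x) i j).
Proof.
move=> Ab; apply: bounded_measurableM; first exact: bounded_measurable_cst.
apply: bounded_measurable_det => i' j'.
by under eq_fun do rewrite !mxE.
Qed.

End bounded_measurable_functions.

Section combinations.
Context {d} {R : realType} {X : measurableMetricType d R}.
Variable nu : {measure set X -> \bar R}.
Implicit Types (T : (X -> R) -> X -> R) (f : X -> R).

Lemma der_op_le T C C' : C <= C' -> der_op nu T C -> der_op nu T C'.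
Proof.
move=> CC' [mT bT DT ZT MT wT]; split=> // M f x fM.
apply: le_trans (bT M f x fM) _; apply: ler_wpM2r => //.
exact: bdlip_ge0 fM.
Qed.

Lemma der_op_bounded_measurable T C M f : der_op nu T C -> bdlip M f ->
  bounded_measurable (T f).
Proof.
move=> derT fM; split; first exact: (der_op_measurable derT fM).
by exists (C * M) => x; exact: (der_op_bounded derT x fM).
Qed.

Lemma integrable_mul_bounded h k : nu.-integrable setT (EFin \o h) ->
  bounded_measurable k -> nu.-integrable setT (EFin \o (fun x => h x * k x)).
Proof.
move=> ih [mk [b kb]].
have := integrableMl measurableT ih mk; apply.
exists b; split; first exact: num_real.
by move=> N bN x _; apply: le_trans (kb x) (ltW bN).
Qed.

Lemma der_op0 : der_op nu (fun _ _ => 0) 0.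
Proof.
split=> [//|M f x _|M f g _ _|M a f _|M f g _ _|M u f _ _ _ h _].
- by rewrite normr0 mul0r.
- by apply: aeW => x; rewrite addr0.
- by apply: aeW => x; rewrite mulr0.
- by apply: aeW => x; rewrite !mulr0 addr0.
- exact: cvg_cst.
Qed.

Lemma der_op_add T1 T2 C1 C2 : der_op nu T1 C1 -> der_op nu T2 C2 ->
  der_op nu (fun f x => T1 f x + T2 f x) (C1 + C2).
Proof.
move=> D1 D2; split.
- move=> M f fM; apply: measurable_funD; first exact: (der_op_measurable D1 fM).
  exact: (der_op_measurable D2 fM).
- move=> M f x fM; apply: le_trans (ler_normD _ _) _; rewrite mulrDl.
  by apply: lerD; [exact: (der_op_bounded D1 x fM)|exact: (der_op_bounded D2 x fM)].
- move=> M f g fM gM; have e1 := der_opD D1 fM gM; have e2 := der_opD D2 fM gM.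
  by apply: filterS2 e1 e2 => x -> ->; rewrite addrACA.
- move=> M a f fM; have e1 := der_opZ D1 a fM; have e2 := der_opZ D2 a fM.
  by apply: filterS2 e1 e2 => x -> ->; rewrite mulrDr.
- move=> M f g fM gM; have e1 := der_opM D1 fM gM; have e2 := der_opM D2 fM gM.
  by apply: filterS2 e1 e2 => x -> ->; rewrite !mulrDr addrACA.
- move=> M u f uM fM uf h ih.
  have split_int v : bdlip M v -> \int[nu]_x (h x * (T1 v x + T2 v x)) =
      \int[nu]_x (h x * T1 v x) + \int[nu]_x (h x * T2 v x).
    move=> vM; rewrite -RintegralD//; last 2 first.
    - exact: (integrable_mul_bounded ih (der_op_bounded_measurable D1 vM)).
    - exact: (integrable_mul_bounded ih (der_op_bounded_measurable D2 vM)).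
    by apply: eq_Rintegral => x _; rewrite mulrDr.
  rewrite (split_int f fM); under eq_fun do rewrite split_int//.
  by apply: cvgD; [exact: (der_op_cvg D1 uM fM uf ih)|exact: (der_op_cvg D2 uM fM uf ih)].
Qed.

Lemma der_op_mul T C k : der_op nu T C -> bounded_measurable k ->
  exists C', der_op nu (fun f x => k x * T f x) C'.
Proof.
move=> D bk; have [mk [b kb]] := bk; exists (`|b| * C); split.
- by move=> M f fM; apply: measurable_funM => //; exact: (der_op_measurable D fM).
- move=> M f x fM; rewrite normrM -mulrA; apply: ler_pM => //.
    exact: le_trans (kb x) (ler_norm b).
  exact: (der_op_bounded D x fM).
- by move=> M f g fM gM; have e := der_opD D fM gM; apply: filterS e => x ->; rewrite mulrDr.
- by move=> M a f fM; have e := der_opZ D a fM; apply: filterS e => x ->; rewrite mulrCA.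
- move=> M f g fM gM; have e := der_opM D fM gM; apply: filterS e => x ->.
  by rewrite mulrDr !(mulrCA (k x)).
- move=> M u f uM fM uf h ih.
  have := der_op_cvg D uM fM uf (integrable_mul_bounded ih bk).
  rewrite (_ : (fun n => \int[nu]_x (h x * k x * T (u n) x)) =
    (fun n => \int[nu]_x (h x * (k x * T (u n) x)))); last first.
    by apply/funext => n; apply: eq_Rintegral => x _; rewrite mulrA.
  by rewrite (_ : \int[nu]_x (h x * k x * T f x) = \int[nu]_x (h x * (k x * T f x)))//;
     apply: eq_Rintegral => x _; rewrite mulrA.
Qed.

Lemma der_op_lincomb (I : Type) (s : seq I) (T : I -> (X -> R) -> X -> R)
    (C : I -> R) (k : I -> X -> R) :
  (forall i, der_op nu (T i) (C i)) -> (forall i, bounded_measurable (k i)) ->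
  exists C', der_op nu (fun f x => \sum_(i <- s) k i x * T i f x) C'.
Proof.
move=> DT kb; elim: s => [|i s [C' IH]].
  exists 0; rewrite (_ : (fun _ _ => _) = (fun _ _ => 0)); first exact: der_op0.
  by apply/funext => f; apply/funext => x; rewrite big_nil.
have [C1 D1] := der_op_mul (DT i) (kb i); exists (C1 + C').
rewrite (_ : (fun _ _ => _) = (fun f x => k i x * T i f x + \sum_(i <- s) k i x * T i f x)).
  exact: der_op_add.
by apply/funext => f; apply/funext => x; rewrite big_cons.
Qed.

End combinations.

(** * From derivations to operators *)

Section essentially_bounded.
Local Open Scope quotient_scope.
Context {d} {R : realType} {X : measurableType d}.
Variable nu : {measure set X -> \bar R}.

Lemma Linfty_measurable (f : Linfty nu) : @measurable_fun d _ X R setT (f : X -> R).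
Proof.
by rewrite /aqEqMfun_to_fun; exact: (measurable_funPT (repr (LebesgueSpace.sort f))).
Qed.

Lemma Linfty_of_bounded_measurable (f : X -> R) : bounded_measurable f ->
  exists g : Linfty nu, (g : X -> R) = f %[ae nu].
Proof.
move=> [mf [b bf]].
pose mF := @isMeasurableFun.Build d _ X (measurableTypeR R) f mf.
pose F : {mfun X >-> measurableTypeR R} := HB.pack f mF.
pose G : {mfun_ nu, X >-> measurableTypeR R} := \pi F.
have GF : (G : X -> R) = f %[ae nu].
  have : \pi_({mfun_ nu, X >-> measurableTypeR R}) (repr G) == \pi F by rewrite reprK.
  by rewrite eqmodE => /asboolP.
have fin : finite_norm nu +oo (G : X -> R).
  rewrite /finite_norm unlock /Lnorm; case: ifPn => // _.
  apply: (@le_lt_trans _ _ b%:E); last exact: ltry.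
  by apply/ess_supP; apply: filterS GF => x /= ->//; rewrite lee_fin bf.
pose fG := isFinLebesgue.Build _ _ _ _ _ (leey 1) G fin.
pose H : Linfty nu := HB.pack_for (Linfty nu) G fG.
by exists H.
Qed.

Lemma ae_le_Linfty_norm (f : X -> R) (b : R) :
  ('N[nu]_+oo[EFin \o f] <= b%:E)%E -> \forall x \ae nu, `|f x| <= b.
Proof.
rewrite unlock /Lnorm; case: ifPn => [nu0|nu0 _].
  by move=> /ess_supP; apply: filterS => x /=; rewrite lee_fin.
apply: measure0_ae; apply/eqP; rewrite -measure_le0.
by move: nu0; rewrite -leNgt.
Qed.

End essentially_bounded.

Section derivation_operators.
Context {d} {R : realType} {X : measurableMetricType d R}.
Implicit Types (f g : X -> R).

Definition lipb_of f : lipb X := insubd (0 : lipb X) f.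

Lemma bdlip_lipb M f : bdlip M f -> f \in lipb_pred (X := X).
Proof.
move=> fM; apply/lipb_predP; exists `|M|, `|M|; split => // [x|x y].
  exact: le_trans (proj1 fM x) (ler_norm M).
apply: le_trans (bdlip_normB x y fM) _; apply: ler_wpM2r; first exact: mdist_ge0.
exact: ler_norm.
Qed.

Lemma lipb_bdlip (F : lipb X) : exists M, bdlip M F.
Proof.
have [M [K [M0 K0 FM FK]]] := (lipb_predP F).1 (lipb_valP F).
exists (M + K); split=> [x|x y]; first by apply: le_trans (FM x) _; rewrite lerDl.
apply: le_trans (ler_norm _) _; apply: le_trans (FK x y) _.
by apply: ler_wpM2r; rewrite ?mdist_ge0// lerDr.
Qed.

Lemma lipb_ofE M f : bdlip M f -> lipb_of f = f :> (X -> R).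
Proof. by move=> /bdlip_lipb fP; exact: insubdK fP. Qed.

Lemma lipb_of_val (F : lipb X) : lipb_of F = F.
Proof. exact: valKd. Qed.

Lemma lipb_norm_le M (F : lipb X) (x : X) : bdlip M F -> 0 <= lipb_norm F <= M.
Proof.
move=> FM; have M0 := bdlip_ge0 x FM.
have sup_le : sup (range (fun x => `|F x|)) <= M.
  apply: ge_sup; first by exists `|F x|; exists x.
  by move=> _ [y _ <-]; exact: (proj1 FM).
have sup_ge : 0 <= sup (range (fun x => `|F x|)).
  apply: (@le_trans _ _ `|F x|) => //; apply: ub_le_sup; last by exists x.
  by exists M => _ [y _ <-]; exact: (proj1 FM).
have lip1 : lip_const F <= M.
  rewrite /lip_const; set S := [set _ | _ in _].
  have [S0|/nonemptyPn ->] := pselect (S !=set0); last by rewrite sup0.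
  apply: ge_sup => // _ [z /= z12 <-].
  rewrite ler_pdivrMr ?mdist_gt0//; exact: bdlip_normB.
by rewrite le_max sup_ge/= ge_max sup_le lip1.
Qed.

Variable nu : {measure set X -> \bar R}.

(** A representative of [D f] that respects the norm bound at every point, not
    just almost everywhere. *)
Definition der_operator (D : derivation nu) (C : R) f x : R :=
  let v := (D (lipb_of f) : X -> R) x in
  if `|v| <= C * lipb_norm (lipb_of f) then v else 0.

Lemma der_operator_der_op (D : derivation nu) : exists C, der_op nu (der_operator D C) C /\
  forall f, \forall x \ae nu, der_operator D C f x = (D (lipb_of f) : X -> R) x.
Proof.
have [C0 DC0] := der_bounded D; pose C := `|C0|.
have C_ge0 : 0 <= C by exact: normr_ge0.
exists C.
have DE f : \forall x \ae nu, der_operator D C f x = (D (lipb_of f) : X -> R) x.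
  have [M FM] := lipb_bdlip (lipb_of f).
  have := ae_le_Linfty_norm (DC0 (lipb_of f)); apply: filterS => x Dx.
  have /andP[n0 _] := lipb_norm_le x FM.
  rewrite /der_operator ifT//; apply: le_trans Dx _.
  by apply: ler_wpM2r => //; exact: ler_norm.
have mD f : measurable_fun setT (der_operator D C f).
  apply: measurable_fun_ifT => //; last exact: Linfty_measurable.
  apply: measurable_fun_ler => //.
  by apply: measurableT_comp => //; exact: Linfty_measurable.
have mDL F : @measurable_fun d _ X R setT (D F : X -> R) by exact: Linfty_measurable.
split=> //; split.
- by move=> M f _; exact: mD.
- move=> M f x fM; have FM : bdlip M (lipb_of f) by rewrite (lipb_ofE fM).
  have /andP[n0 nM] := lipb_norm_le x FM.
  rewrite /der_operator; case: ifP => [vle|_].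
    by apply: le_trans vle _; apply: ler_wpM2l.
  by rewrite normr0 mulr_ge0// (le_trans n0).
- move=> M f g fM gM.
  have E : lipb_of (fun y => f y + g y) = 1 *: lipb_of f + lipb_of g.
    apply: val_inj; rewrite scale1r [LHS](lipb_ofE (bdlipD fM gM)).
    by rewrite raddfD /= (lipb_ofE fM) (lipb_ofE gM).
  have e1 := DE (fun y => f y + g y); have e2 := DE f; have e3 := DE g.
  have e4 := der_linear D 1 (lipb_of f) (lipb_of g).
  have e23 : \forall x \ae nu, der_operator D C f x = (D (lipb_of f) : X -> R) x /\
      der_operator D C g x = (D (lipb_of g) : X -> R) x.
    by apply: filterS2 e2 e3 => x.
  apply: filterS3 e1 e23 e4 => x -> [-> ->]; rewrite E => /(_ I) ->.
  by rewrite mul1r.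
- move=> M a f fM.
  (* [der_linear] always adds a second function: take [f] itself. *)
  have E : lipb_of (fun y => a * f y) = (a - 1) *: lipb_of f + lipb_of f.
    rewrite -{2}[lipb_of f]scale1r -scalerDl subrK.
    apply: val_inj; rewrite [LHS](lipb_ofE (bdlipZ a fM)).
    by rewrite linearZ /= (lipb_ofE fM).
  have e1 := DE (fun y => a * f y); have e2 := DE f.
  have e4 := der_linear D (a - 1) (lipb_of f) (lipb_of f).
  apply: filterS3 e1 e2 e4 => x -> ->; rewrite E => /(_ I) ->.
  by rewrite mulrBl mul1r subrK.
- move=> M f g fM gM.
  have E : lipb_of (fun y => f y * g y) = lipb_of f * lipb_of g.
    apply: val_inj; rewrite [LHS](lipb_ofE (bdlipM fM gM)).
    by rewrite /= (lipb_ofE fM) (lipb_ofE gM).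
  have e1 := DE (fun y => f y * g y); have e2 := DE f; have e3 := DE g.
  have e4 := der_leibniz D (lipb_of f) (lipb_of g).
  have e23 : \forall x \ae nu, der_operator D C f x = (D (lipb_of f) : X -> R) x /\
      der_operator D C g x = (D (lipb_of g) : X -> R) x.
    by apply: filterS2 e2 e3 => x.
  apply: filterS3 e1 e23 e4 => x -> [-> ->]; rewrite E => /(_ I) ->.
  by rewrite (lipb_ofE fM) (lipb_ofE gM).
- move=> M u f uM fM uf h ih.
  have intE v : \int[nu]_x (h x * der_operator D C v x) =
      \int[nu]_x (h x * (D (lipb_of v) : X -> R) x).
    have /integrableP[/measurable_EFinP mh _] := ih.
    congr fine; apply: ae_eq_integral => //.
    + by apply/measurable_EFinP; exact: measurable_funM.
    + by apply/measurable_EFinP; exact: measurable_funM.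
    + by apply: filterS (DE v) => x -> _.
  rewrite intE; under eq_fun do rewrite intE.
  apply: der_weak_star_continuous => //; split.
    move=> x; rewrite (lipb_ofE fM); under eq_fun do rewrite (lipb_ofE (uM _)).
    exact: uf.
  have [[x _]|X0] := pselect (exists x : X, True).
    exists M => n; have FM : bdlip M (lipb_of (u n)) by rewrite (lipb_ofE (uM n)).
    by have /andP[] := lipb_norm_le x FM.
  exists (lipb_norm (lipb_of (u 0%N))) => n.
  suff -> : u n = u 0%N by [].
  by apply/funext => x; exfalso; apply: X0; exists x.
Qed.

End derivation_operators.

(** * Jacobians of independent derivations *)

Section jacobians.
Context {d} {R : realType} {X : measurableMetricType d R}.
Variable nu : {measure set X -> \bar R}.
Variables (T : nat -> (X -> R) -> X -> R) (C : nat -> R) (n : nat).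
Hypothesis derT : forall i, der_op nu (T i) (C i).

Definition jacobian m (g : nat -> X -> R) x : 'M[R]_m := \matrix_(i, j) T i (g j) x.

Lemma jacobian_bounded_measurable m g : (forall j, bdlip 1 (g j)) ->
  forall i j, bounded_measurable (fun x => jacobian m g x i j).
Proof.
move=> gM i j; under eq_fun do rewrite mxE.
exact: (der_op_bounded_measurable (derT i) (gM j)).
Qed.

Hypothesis indep : forall k : nat -> X -> R, (forall i, bounded_measurable (k i)) ->
  (forall f, bdlip 1 f -> \forall x \ae nu, \sum_(i < n) k i x * T i f x = 0) ->
  forall i, (i < n)%N -> \forall x \ae nu, k i x = 0.

(** Were all [(m+1)]-minors bordering a nonzero [m]-minor null, the cofactors of
    the new column would be a nontrivial linear relation. *)
Lemma border_jacobian m g : (m < n)%N -> (forall j, bdlip 1 (g j)) ->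
  ~ (\forall x \ae nu, \det (jacobian m g x) = 0) ->
  exists2 g', forall j, bdlip 1 (g' j) &
    ~ (\forall x \ae nu, \det (jacobian m.+1 g' x) = 0).
Proof.
move=> mn gM ndet; apply: contrapT => no_g'; apply: ndet.
pose k i x := if (i < m.+1)%N then
  cofactor (jacobian m.+1 g x) (inord i) ord_max else 0.
have kb i : bounded_measurable (k i).
  rewrite /k; case: (i < m.+1)%N; last exact: bounded_measurable_cst.
  apply: bounded_measurable_cofactor; exact: jacobian_bounded_measurable.
have det_km x : k m x = \det (jacobian m g x).
  rewrite /k ltnSn /cofactor.
  have -> : inord m = ord_max :> 'I_m.+1 by apply: val_inj; rewrite /= inordK.
  rewrite (_ : (-1) ^+ _ = 1 :> R) ?mul1r.
  congr (\det _).
    by apply/matrixP => i j; rewrite !mxE !lift_max.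
  by rewrite addnn -mul2n exprM sqrrN expr1n expr1n.
suff : \forall x \ae nu, k m x = 0 by apply: filterS => x <-.
apply: (indep kb _ mn) => f fM.
pose g' j := if j == m then f else g j.
have g'M j : bdlip 1 (g' j) by rewrite /g'; case: ifP.
have : \forall x \ae nu, \det (jacobian m.+1 g' x) = 0.
  by apply: contrapT => ndet'; apply: no_g'; exists g'.
apply: filterS => x; rewrite (expand_det_col _ ord_max) => det0; rewrite -[RHS]det0.
have -> : \sum_(i < n) k i x * T i f x = \sum_(i < m.+1) k i x * T i f x.
  rewrite (big_ord_widen _ (fun i => k i x * T i f x) mn) [RHS]big_mkcond /=.
  by apply: eq_bigr => i _; rewrite /k; case: ifP => //; rewrite mul0r.
apply: eq_bigr => i _; rewrite mxE /g' eqxx mulrC; congr (_ * _).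
rewrite /k ltn_ord inord_val /cofactor; congr (_ * \det _).
apply/matrixP => i' j'; rewrite !mxE lift_max /g' ifN//.
by rewrite neq_ltn ltn_ord.
Qed.

Lemma exists_jacobian : ~ (\forall x \ae nu, False) ->
  exists2 g : nat -> X -> R, forall j, bdlip 1 (g j) &
    ~ (\forall x \ae nu, \det (jacobian n g x) = 0).
Proof.
move=> nontrivial.
suff H m : (m <= n)%N -> exists2 g : nat -> X -> R, forall j, bdlip 1 (g j) &
    ~ (\forall x \ae nu, \det (jacobian m g x) = 0) by exact: H (leqnn n).
elim: m => [_|m IH mn].
  exists (fun _ _ => 0) => [j|det0]; first by apply: bdlip_le (bdlip_cst 0); rewrite normr0.
  apply: nontrivial; apply: filterS det0 => x /eqP.
  by rewrite det_mx00 oner_eq0.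
have [g gM ndet] := IH (ltnW mn).
exact: (border_jacobian mn gM ndet).
Qed.

End jacobians.

Section independent_derivations.
Context {d} {R : realType} {X : measurableMetricType d R}.
Variable nu : {measure set X -> \bar R}.
Hypothesis borel : forall A : set X, open A -> measurable A.
Hypothesis inner_compact : forall V : set X, measurable V -> (0 < nu V)%E ->
  exists K : set X, [/\ compact K, measurable K, K `<=` V & (0 < nu K < +oo)%E].

Lemma det_neq0_bounded_below (h : X -> R) : bounded_measurable h ->
  ~ (\forall x \ae nu, h x = 0) ->
  exists eta : R, [/\ 0 < eta, measurable [set x | eta <= `|h x|] &
    (0 < nu [set x | (eta <= `|h x|)%R])%E].
Proof.
move=> [mh _] nh; pose e (m : nat) : R := m.+1%:R^-1.
have e0 m : 0 < e m by rewrite invr_gt0.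
have mV m : measurable [set x | e m <= `|h x|].
  have mnh : measurable_fun setT (fun x => `|h x|) by exact: measurableT_comp.
  have := measurable_fun_ler (measurable_cst (e m)) mnh measurableT (Y := [set true]).
  by rewrite setTI; apply.
apply: contrapT => all0; apply: nh.
have : forall m, \forall x \ae nu, `|h x| < e m.
  move=> m; exists [set x | e m <= `|h x|]; split => //.
    apply/eqP; rewrite -measure_le0 leNgt; apply/negP => pos.
    by apply: all0; exists (e m).
  by move=> x /= /negP; rewrite -leNgt.
move=> /ae_foralln; apply: filterS => x hx.
apply/eqP; rewrite -normr_le0 leNgt; apply/negP => hx0.
have := hx (Num.trunc (`|h x|^-1)); apply/negP; rewrite -leNgt /e.
have i0 : 0 <= `|h x|^-1 by rewrite invr_ge0.
have /andP[_ i1] := truncn_itv i0.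
by rewrite invf_ple ?posrE//; exact: ltW.
Qed.

(** Cramer's rule turns the derivations into operators dual to the coordinates
    [g j] on a compact set where their Jacobian is bounded away from [0]. *)
Lemma independent_card_le n (D : 'I_n -> derivation nu) (s : R) :
  (forall lambda : 'I_n -> Linfty nu,
    (forall f : lipb X,
      (fun x => \sum_(i < n) lambda i x * D i f x) = cst 0 %[ae nu]) ->
    forall i, (lambda i : X -> R) = cst 0 %[ae nu]) ->
  (0 < nu setT)%E -> assouad_exponent X s -> n%:R <= s.
Proof.
move=> indepD nu0 sX.
have /choice[C0 C0P] i := der_operator_der_op (D i).
pose T (k : nat) : (X -> R) -> X -> R :=
  oapp (fun i : 'I_n => der_operator (D i) (C0 i)) (fun _ _ => 0) (insub k).
pose C (k : nat) : R := oapp C0 0 (insub k : option 'I_n).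
have derT k : der_op nu (T k) (C k).
  rewrite /T /C; case: insubP => [i _ _|_] /=; first exact: (C0P i).1.
  exact: der_op0.
have TE (i : 'I_n) : T i = der_operator (D i) (C0 i) by rewrite /T valK.
have indepT (k : nat -> X -> R) : (forall i, bounded_measurable (k i)) ->
    (forall f, bdlip 1 f -> \forall x \ae nu, \sum_(i < n) k i x * T i f x = 0) ->
    forall i, (i < n)%N -> \forall x \ae nu, k i x = 0.
  move=> kb krel i ni.
  have /choice[l lP] (i : 'I_n) := Linfty_of_bounded_measurable nu (kb i).
  have /indepD l0 (f : lipb X) :
      (fun x => \sum_(i < n) l i x * D i f x) = cst 0 %[ae nu].
    have [M fM] := lipb_bdlip f; pose c := (`|M| + 1)^-1.
    have c0 : 0 < c by rewrite invr_gt0 ltr_wpDl.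
    have cfM : bdlip 1 (fun x => c * f x).
      apply: bdlip_le (bdlipZ c fM); rewrite gtr0_norm// ler_pdivrMl ?mulr1 ?ltr_wpDl//.
      by have := ler_norm M; lra.
    have Dl : \forall x \ae nu, forall i : 'I_n, l i x = k i x.
      by apply: filter_forall => i'; apply: filterS (lP i') => x; exact.
    have DT : \forall x \ae nu, forall i : 'I_n,
        T i (fun x => c * f x) x = c * (D i f : X -> R) x.
      apply: filter_forall => i'; have e1 := der_opZ (derT i') c fM.
      have e2 := (C0P i').2 f; rewrite lipb_of_val in e2.
      by rewrite !TE in e1 *; apply: filterS2 e1 e2 => x -> ->.
    apply: filterS3 (krel _ cfM) Dl DT => x rel lx Tx _ /=.
    apply/eqP; rewrite -(mulrI_eq0 _ (mulfI (lt0r_neq0 c0))) -[X in _ == X]rel.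
    rewrite mulr_sumr; apply/eqP/eq_bigr => i' _.
    by rewrite lx Tx mulrCA.
  have := l0 (Ordinal ni); have := lP (Ordinal ni).
  by apply: filterS2 => x /= lk lz; rewrite -lk// lz.
have nontrivial : ~ (\forall x \ae nu, False).
  move=> [N [mN N0 subN]]; have NT : N = setT.
    by apply/seteqP; split=> // x _; apply: subN.
  by move: nu0; rewrite -NT N0 ltxx.
have [g gM ndet] := exists_jacobian derT indepT nontrivial.
have Jb i j : bounded_measurable (fun x => jacobian T n g x i j).
  exact: (jacobian_bounded_measurable derT gM).
pose h x := \det (jacobian T n g x).
have hb : bounded_measurable h by exact: bounded_measurable_det.
have [eta [eta0 mV V0]] := det_neq0_bounded_below hb ndet.
set V := [set x | _] in mV V0.
have [K [cK mK KV K0]] := inner_compact mV V0.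
(* A measurable function equal to [1 / h] on [V] and to [0] elsewhere. *)
pose w x := \1_V x * (h x * (h x ^+ 2) `^ (-1)).
have wE x : V x -> w x = (h x)^-1.
  move=> Vx; have hx0 : h x != 0.
    by rewrite -normr_gt0; apply: lt_le_trans Vx.
  rewrite /w indicE mem_set// mul1r powR_inv1 ?sqr_ge0// expr2 invfM mulrA.
  by rewrite mulfV// mul1r.
have wb : bounded_measurable w.
  split.
    rewrite /w; apply: measurable_funM; first exact: measurable_indic.
    apply: measurable_funM; first exact: hb.1.
    exact: (measurableT_comp (measurable_powR (-1)) (measurable_funX 2 hb.1)).
  exists eta^-1 => x; have [Vx|nVx] := pselect (V x).
    by rewrite wE// normfV lef_pV2 ?posrE//; exact: lt_le_trans Vx.
  by rewrite /w indicE memNset// mul0r normr0 invr_ge0 ltW.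
pose lam i k x := w x * cofactor (jacobian T n g x) k i.
have lamb (i k : 'I_n) : bounded_measurable (lam i k).
  by apply: bounded_measurableM => //; exact: bounded_measurable_cofactor.
pose T' (i : 'I_n) f x := \sum_(k < n) lam i k x * T k f x.
have /choice[C' C'P] (i : 'I_n) : exists C', der_op nu (T' i) C'.
  exact: (der_op_lincomb _ (fun k : 'I_n => derT k) (lamb i)).
pose Cmax := 1 + \sum_i `|C' i|.
have sum0 : 0 <= \sum_i `|C' i| by exact: sumr_ge0.
have derT' i : der_op nu (T' i) Cmax.
  apply: der_op_le (C'P i); apply: le_trans (ler_norm _) _.
  rewrite /Cmax (bigD1 i)//= addrCA lerDl addr_ge0// sumr_ge0//.
have dual (i j : 'I_n) : \forall x \ae nu, K x -> T' i (g j) x = (i == j)%:R.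
  apply: aeW => x /KV Vx.
  have hx0 : h x != 0 by rewrite -normr_gt0; apply: lt_le_trans Vx.
  have := congr1 (fun A : 'M[R]_n => A i j) (mul_adj_mx (jacobian T n g x)).
  rewrite !mxE => cramer.
  transitivity ((h x)^-1 * (\det (jacobian T n g x) *+ (i == j))).
    rewrite -cramer mulr_sumr; apply: eq_bigr => k _.
    by rewrite /lam wE// !mxE -mulrA.
  by rewrite -/(h x) mulrnAr mulVf.
have C1 : 1 <= Cmax by rewrite lerDl.
have := @card_le_assouad_exponent R d X nu K 'I_n g T' Cmax s borel cK mK K0
  (fun j => gM j) derT' dual C1 sX.
by rewrite card_ord.
Qed.

End independent_derivations.

(** * Radon measures and the index *)

Section radon.
Context {d} {R : realType} {X : measurableMetricType d R}.
Variable mu : {measure set X -> \bar R}.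
Hypothesis radon_mu : radon_measure mu.

Lemma compact_finite_radon (K : set X) : compact K -> (mu K < +oo)%E.
Proof.
move=> cK.
have /choice[A AP] (x : X) := radon_locally_finite radon_mu x.
have [|x Kx|F _ KF] := compact_finite_cover cK (D := K) (f := A).
- by move=> x _; case: (AP x).
- by exists x => //; case: (AP x).
have mA x : measurable (A x) by case: (AP x) => /(radon_borel radon_mu).
have mK : measurable K.
  apply: (measurable_closed_set (radon_borel radon_mu)).
  exact: compact_closed (metric_hausdorff (T := X)) cK.
have [B [mB Bfin FB]] : exists B, [/\ measurable B, (mu B < +oo)%E &
    forall x, x \in enum_fset F -> A x `<=` B].
  elim: (enum_fset F) => [|x l [B [mB Bfin lB]]].
    by exists set0; split => //; rewrite measure0.
  exists (A x `|` B); split => [||y].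
  - exact: measurableU.
  - apply: le_lt_trans (measureU2 mu (mA x) mB) _; apply: lte_add_pinfty => //.
    by case: (AP x).
  - rewrite inE => /predU1P[->|/lB yB]; first exact: subsetUl.
    by apply: subset_trans yB _; exact: subsetUr.
apply: le_lt_trans Bfin; apply: le_measure; rewrite ?inE//.
by move=> x /KF[y Fy Ayx]; exact: (FB y Fy).
Qed.

Lemma mrestr_inner_compact (U : set X) (mU : measurable U) (V : set X) :
  measurable V -> (0 < mrestr mu mU V)%E ->
  exists K : set X, [/\ compact K, measurable K, K `<=` V &
    (0 < mrestr mu mU K < +oo)%E].
Proof.
move=> mV; rewrite /mrestr (radon_inner_regular radon_mu (measurableI _ _ mV mU)).
move=> /ereal_sup_gt[_ [K [cK KVU] <-] K0].
exists K; split => //.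
- apply: (measurable_closed_set (radon_borel radon_mu)).
  exact: compact_closed (metric_hausdorff (T := X)) cK.
- by move=> x /KVU[].
- by rewrite setIidl ?K0 ?compact_finite_radon// => x /KVU[].
Qed.

End radon.

Lemma card_eq_le_of_injections (T : Type) (R : realType) (S : set T) (b : R) :
  (forall n (D : 'I_n -> T), injective D -> (forall i, S (D i)) -> n%:R <= b) ->
  exists2 n : nat, (S #= `I_n)%card & n%:R <= b.
Proof.
move=> Sb.
have le_b n : (`I_n #<= S)%card -> n%:R <= b.
  move=> /card_leP[f].
  pose D (i : 'I_n) : T := set_val (f (SigSub (mem_set (ltn_ord i : `I_n i)))).
  apply: (Sb n D) => [i j|i]; last exact: set_valP.
  move=> /val_inj fij; apply: val_inj.
  have /(congr1 set_val) := inj (in_setT _) (in_setT _) fij.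
  exact.
have [[n Sn]|/infiniteP Sinf] := pselect (finite_set S).
  by exists n => //; apply: le_b; have /card_eqPle[_] := Sn.
exfalso; have b0 : 0 <= `|b| by [].
have /andP[_] := truncn_itv b0; apply/negP; rewrite -leNgt.
apply: le_trans (ler_norm b); apply: le_b.
by apply: card_le_trans Sinf; exact: subset_card_le.
Qed.

Theorem corollary5p99 (R : realType) (d : measure_display)
    (X : measurableMetricType d R) (mu : {measure set X -> \bar R}) (D : R) :
  assouad_dim X = D%:E -> radon_measure mu -> index_locally_bounded mu D.
Proof.
move=> dimX radon_mu U mU U0 S indepS.
apply: card_eq_le_of_injections => n Ds injD SD.
rewrite -lee_fin -dimX; apply: le_ereal_inf_tmp => _ [s sX <-]; rewrite lee_fin.
have card_le := (@independent_card_le _ _ _ (mrestr mu mU) (radon_borel radon_mu)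
  (@mrestr_inner_compact _ _ _ _ radon_mu U mU) n Ds s).
apply: card_le => //.
- by move=> l rel; exact: indepS injD SD rel.
- by rewrite /= /mrestr setTI.
Qed.
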